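(* Let $q$ be a power of a prime $p$, $K$ an algebraic closure of $\mathbb{F}_q$, and $\overline{\mathrm{AGL}}(2,q)$ the stabilizer in $\mathrm{PGL}(3,q)$ of a point of $\mathrm{PG}(2,q)$, acting on $\mathrm{PG}(2,K)$. Then $\varepsilon(\overline{\mathrm{AGL}}(2,q))=q^2-q$.
   Context: Plane curves are projective plane curves over $K$; irreducible means irreducible over $K$; $G$-invariant means mapped onto itself by every element of $G$. $d(G)$ is the smallest degree of a $G$-invariant irreducible plane curve other than a line; $\varepsilon(G)=d'(G)-d(G)$, where $d'(G)$ is the smallest degree larger than $d(G)$ of a $G$-invariant irreducible plane curve (the first gap in the degree spectrum). Here $d(\overline{\mathrm{AGL}}(2,q))=q^3-q^2$. *)

(* Defs.v *)
From HB Require Import structures.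
From mathcomp Require Import all_boot all_order all_algebra.
From mathcomp Require Import mpoly.
Set Implicit Arguments. Unset Strict Implicit. Unset Printing Implicit Defensive.
Import GRing.Theory.
Local Open Scope ring_scope.

(* K is an algebraic closure of F_p: algebraically closed, of characteristic p,
   and every element is algebraic over the prime field (coefficients n%:R). *)
Definition in_prime_field (K : fieldType) (c : K) : Prop := exists n : nat, c = n%:R.

Definition alg_over_prime_field (K : fieldType) : Prop :=
  forall x : K, exists P : {poly K},
    [/\ P != 0, forall i, in_prime_field P`_i & root P x].

Definition in_Fq (K : fieldType) (q : nat) (c : K) : bool := c ^+ q == c.

Definition Fq_mx (K : fieldType) (q : nat) m n (A : 'M[K]_(m, n)) : Prop :=
  forall i j, in_Fq q (A i j).

Definition PG2q_point (K : fieldType) (q : nat) (v : 'cV[K]_3) : Prop :=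
  v != 0 /\ Fq_mx q v.

(* elements of the stabilizer of the point v in PGL(3,q)
   (represented by invertible matrices over F_q fixing v projectively) *)
Definition AGLbar_elt (K : fieldType) (q : nat) (v : 'cV[K]_3) (A : 'M[K]_3) : Prop :=
  [/\ Fq_mx q A, A \in unitmx & exists c : K, A *m v = c *: v].

Definition lin_subst (K : fieldType) (A : 'M[K]_3) : 3.-tuple ({mpoly K[3]}) :=
  [tuple \sum_(j < 3) A i j *: 'X_j | i < 3].

Definition mirreducible (K : fieldType) (F : {mpoly K[3]}) : Prop :=
  (1 < msize F)%N /\
  forall G H : {mpoly K[3]}, F = G * H ->
     (msize G <= 1)%N \/ (msize H <= 1)%N.

Definition curve_invariant (K : fieldType) (A : 'M[K]_3) (F : {mpoly K[3]}) : Prop :=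
  exists2 c : K, c != 0 & comp_mpoly (lin_subst A) F = c *: F.

Definition inv_irr_degree (K : fieldType) (G : 'M[K]_3 -> Prop) (n : nat) : Prop :=
  exists F : {mpoly K[3]},
    [/\ F \is (ishomog1 n mdeg), mirreducible F &
        forall A, G A -> curve_invariant A F].

(* eps(G) = e : with d = d(G) the least degree >= 2 (i.e. not a line) of a
   G-invariant irreducible curve, d + e is the least such degree larger than d. *)
Definition first_gap (S : nat -> Prop) (e : nat) : Prop :=
  exists d : nat,
    [/\ (2 <= d)%N /\ S d, (forall n, (2 <= n)%N -> S n -> (d <= n)%N),
        S (d + e)%N, (0 < e)%N &
        forall n, (d < n)%N -> (n < d + e)%N -> ~ S n].

(* Main.v *)
Require Import Defs.
From HB Require Import structures.
From mathcomp Require Import all_boot all_order all_algebra.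
From mathcomp Require Import perm cyclic separable ring zify.
From mathcomp Require Import mpoly.
Set Implicit Arguments. Unset Strict Implicit. Unset Printing Implicit Defensive.
Import GRing.Theory.
Local Open Scope ring_scope.

(** Move the fixed point to (0 : 0 : 1), and let L and Q be the Dickson
    semi-invariants of GL(2, q) in y, z, of degrees q + 1 and q^2 - q, and
    V = x^(q^2) - Q x^q + L^(q-1) x the product of the translates x + b y + c z.

    Lower bound: an invariant F is fixed by the translations x -> x + b y + c z,
    so in the chart z = 1 it is a polynomial in V, and the dilations
    of x make its degree in V a multiple of q - 1; this gives degree at least
    q^2 (q - 1).  If the degree is less than q^3 - q, the leading coefficient in x
    is, by the same argument in one variable less, a polynomial of degree divisible
    by q (q - 1) in y and smaller than that, hence constant, and the symmetry
    z -> z + y shows that deg F = deg_x F.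

    Existence: the degrees q^3 - q^2 and q^3 - q are those of V^(q-1) + Q^q and
    V^(q-1) Q + L^(q (q-1)).  The second is irreducible by Eisenstein at a simple
    root of Q, in the variable 1/x.  For the first, total ramification of index q
    over the F_q-rational lines through the fixed point forces every factor to be
    invariant under the translations, hence a polynomial in V; the cusp of type
    (q - 1, q) at V = 0, Q = 0 then excludes a proper factor. *)

(** * Composition and Newton polygons *)

Lemma comp_poly_inj0 (R : idomainType) (V g : {poly R}) :
  (1 < size V)%N -> g \Po V = 0 -> g = 0.
Proof.
move=> sV gV0; have [s0|s1] := leqP (size g) 1.
  by rewrite (size1_polyC s0) comp_polyC in gV0 *.
have := size_comp_poly g V; rewrite gV0 size_poly0 /=.
move/esym/eqP; rewrite muln_eq0; move: s1 sV.
by case: (size g) => [|[]] // a; case: (size V) => [|[]].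
Qed.

Lemma comp_poly_inj (R : idomainType) (V g h : {poly R}) :
  (1 < size V)%N -> g \Po V = h \Po V -> g = h.
Proof.
move=> sV e; apply/eqP; rewrite -subr_eq0; apply/eqP.
by apply: (comp_poly_inj0 sV); rewrite comp_polyB e subrr.
Qed.

(** Division by [V], with induction on the degree: translating by [b] gives [f(b) = f(0)], so
    [f - f(0)] vanishes on all of [B] and [V], monic of degree [size B], divides it; the quotient
    inherits the invariance. *)
Lemma translation_invariant_comp (R : idomainType) (V : {poly R}) (B : seq R) :
  V \is monic -> uniq B -> size V = (size B).+1 -> (0 < size B)%N ->
  {in B, forall b, root V b} ->
  {in B, forall b, V \Po ('X + b%:P) = V} ->
  forall f, {in B, forall b, f \Po ('X + b%:P) = f} -> exists g, f = g \Po V.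
Proof.
move=> monV uB sV B0 rV tV f; move: {2}(size f) (leqnn (size f)) => n.
elim: n f => [|n IH] f.
  by rewrite leqn0 size_poly_eq0 => /eqP -> _; exists 0; rewrite comp_poly0.
move=> sf tf; have [s1|s1] := leqP (size f) 1.
  by exists f; rewrite {2}(size1_polyC s1) comp_polyC -size1_polyC.
set c := f.[0].
have fb : {in B, forall b, root (f - c%:P) b}.
  move=> b bB; rewrite rootE hornerD hornerN hornerC /c.
  by rewrite -[in f.[0]](tf b bB) horner_comp !hornerE subrr.
have := Pdiv.RingMonic.rdivp_eq monV (f - c%:P).
set k := Pdiv.Ring.rdivp _ _; set r := Pdiv.Ring.rmodp _ _ => e.
have r0 : r = 0.
  apply/eqP/negP => /negP rn0.
  have ar : all (root r) B.
    apply/allP => b bB; have := fb b bB.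
    by rewrite e rootE hornerD hornerM (eqP (rV b bB)) mulr0 add0r.
  have := max_poly_roots rn0 ar uB.
  by rewrite ltnNge -ltnS -sV Pdiv.Ring.ltn_rmodpN0 // monic_neq0.
rewrite r0 addr0 in e.
have kn0 : k != 0.
  apply/eqP => k0; move: e; rewrite k0 mul0r => /eqP; rewrite subr_eq0 => /eqP e.
  by move: s1; rewrite e size_polyC ltnNge leq_b1.
have sk : (size k <= n)%N.
  have : size (f - c%:P) = size f.
    by rewrite size_polyDl // size_polyN size_polyC (leq_ltn_trans (leq_b1 _)).
  rewrite e (size_mul kn0 (monic_neq0 monV)) sV.
  by move=> E; rewrite -ltnS; apply: leq_trans sf; rewrite -E addnS /= -addn1 leq_add2l.
have tk : {in B, forall b, k \Po ('X + b%:P) = k}.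
  move=> b bB; apply/(mulIf (monic_neq0 monV)).
  by rewrite -e -[in LHS](tV b bB) -comp_polyM -e comp_polyB comp_polyC tf.
have [g kg] := IH k sk tk.
exists ('X * g + c%:P).
by rewrite comp_polyD comp_polyM comp_polyX comp_polyC -kg mulrC -e subrK.
Qed.

Lemma mul_polyXn_split (R : idomainType) (p r w : {poly R}) (n : nat) :
  p * r = 'X^n * w -> w`_0 != 0 ->
  exists (n1 n2 : nat) (p' r' : {poly R}), [/\ (n1 + n2)%N = n, p = 'X^n1 * p', r = 'X^n2 * r' &
     p'`_0 * r'`_0 = w`_0].
Proof.
elim: n p r => [|n IH] p r e w0.
  exists 0%N, 0%N, p, r; split=> //; rewrite ?expr0 ?mul1r //.
  by rewrite -[w]mul1r -(expr0 'X) -e !coef0M.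
have : p`_0 * r`_0 = 0 by rewrite -coef0M e coefXnM.
have red (s : {poly R}) : s`_0 = 0 -> exists s', s = 'X * s'.
  move=> s0; have : root s 0 by rewrite rootE horner_coef0 s0.
  by case/factor_theorem => s' ->; exists s'; rewrite subr0 mulrC.
move/eqP; rewrite mulf_eq0 => /orP[] /eqP /red [s es].
  have {}e : s * r = 'X^n * w.
    by apply: (mulfI (negbT (polyX_eq0 R))); rewrite mulrA -es e exprS mulrA.
  have [n1 [n2 [p' [r' [<- es' er e0]]]]] := IH _ _ e w0.
  by exists n1.+1, n2, p', r'; split=> //; rewrite es es' exprS mulrA.
have {}e : p * s = 'X^n * w.
  by apply: (mulfI (negbT (polyX_eq0 R))); rewrite mulrCA -es e exprS mulrA.
have [n1 [n2 [p' [r' [<- ep er e0]]]]] := IH _ _ e w0.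
by exists n1, n2.+1, p', r'; split=> //; rewrite ?addnS // es er exprS mulrA.
Qed.

(** * Weighted substitutions at a point and one-segment Newton polygons *)

Section WeightedSubstitution.
Variables (K : fieldType) (a b : nat) (x0 y0 : K).

(** In the source the outer variable is x and the inner one y. In the target the outer variable is
    called T and the inner one S: x becomes [x0 + S T^b] and y becomes [y0 + T^a], so the order in T
    is the weighted order at [(x0, y0)], while S still records the power of [x - x0]. *)
Definition wsub : {poly {poly K}} -> {poly {poly K}} :=
  horner_eval (x0%:P%:P + 'X%:P * 'X^b) \o
  map_poly (horner_eval (y0%:P%:P + 'X^a) \o map_poly (polyC \o polyC)).

HB.instance Definition _ := GRing.RMorphism.on wsub.

(** A monomial [(x - x0)^i (y - y0)^j] is sent to [S^i T^(b i + a j)]; this is the resulting lattice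
    condition on exponents. *)
Definition wexpo (p : {poly {poly K}}) : Prop :=
  forall k i, p`_k`_i != 0 -> exists j, k = (b * i + a * j)%N.

Lemma wexpoD p r : wexpo p -> wexpo r -> wexpo (p + r).
Proof.
move=> wp wr k i; rewrite !coefD => n0.
have [p0|] := eqVneq p`_k`_i 0; last exact: wp.
by apply: wr; move: n0; rewrite p0 add0r.
Qed.

Lemma wexpoM p r : wexpo p -> wexpo r -> wexpo (p * r).
Proof.
move=> wp wr k i; rewrite coefM coef_sum => n0.
have [u nu] : exists u : 'I_k.+1, (p`_u * r`_(k - u))`_i != 0.
  apply/existsP; apply: contraNT n0; rewrite negb_exists => /forallP h.
  by rewrite big1 // => u _; apply/eqP; have := h u; rewrite negbK.
move: nu; rewrite coefM => n1.
have [v] : exists v : 'I_i.+1, p`_u`_v * r`_(k - u)`_(i - v) != 0.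
  apply/existsP; apply: contraNT n1; rewrite negb_exists => /forallP h.
  by rewrite big1 // => v _; apply/eqP; have := h v; rewrite negbK.
rewrite mulf_eq0 negb_or => /andP[/wp [j ej] /wr [l el]].
exists (j + l)%N; have := ltn_ord u; have := ltn_ord v; nia.
Qed.

Lemma wexpoC c : wexpo c%:P%:P.
Proof.
move=> k i; rewrite coefC; have [->|_] := eqVneq k 0%N; last by rewrite coef0 eqxx.
rewrite coefC; have [->|_] := eqVneq i 0%N; last by rewrite eqxx.
by exists 0%N; rewrite !muln0.
Qed.

Lemma wexpo0 : wexpo 0.
Proof. by move=> k i; rewrite !coef0 eqxx. Qed.

Lemma wexpo_wsub p : wexpo (wsub p).
Proof.
have w1 : wexpo (y0%:P%:P + 'X^a).
  apply: wexpoD; first exact: wexpoC.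
  move=> k i; rewrite coefXn; have [->|_] := eqVneq k a; last by rewrite coef0 eqxx.
  rewrite coef1; have [->|_] := eqVneq i 0%N; last by rewrite eqxx.
  by exists 1%N; rewrite muln0 muln1.
have w2 : wexpo (x0%:P%:P + 'X%:P * 'X^b).
  apply: wexpoD; first exact: wexpoC.
  move=> k i; rewrite coefCM coefXn; have [->|_] := eqVneq k b; last by rewrite mulr0 coef0 eqxx.
  rewrite mulr1 coefX; have [->|_] := eqVneq i 1%N; last by rewrite eqxx.
  by exists 0%N; rewrite muln0 muln1 addn0.
rewrite /wsub /=; elim/poly_ind: p => [|p c IH].
  by rewrite rmorph0 /horner_eval horner0; exact: wexpo0.
rewrite rmorphD rmorphM /= map_polyX map_polyC /horner_eval hornerMXaddC.
apply: wexpoD; first exact: wexpoM.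
rewrite /=; elim/poly_ind: c => [|c d IHc].
  by rewrite /horner_eval rmorph0 horner0; exact: wexpo0.
rewrite /horner_eval rmorphD rmorphM /= map_polyX map_polyC hornerMXaddC.
by apply: wexpoD; [exact: wexpoM | exact: wexpoC].
Qed.

Lemma wsubX : wsub 'X = x0%:P%:P + 'X%:P * 'X^b.
Proof. by rewrite /wsub /= map_polyX /horner_eval hornerX. Qed.

Lemma wsubC c : wsub c%:P = (map_poly (polyC \o polyC) c).[y0%:P%:P + 'X^a].
Proof. by rewrite /wsub /= map_polyC /horner_eval hornerC. Qed.

Hypothesis (a0 : (0 < a)%N) (b0 : (0 < b)%N).

Lemma wsub_coef00 p : (wsub p)`_0`_0 = p.[x0%:P].[y0].
Proof.
rewrite -!horner_coef0; elim/poly_ind: p => [|p c IH].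
  by rewrite rmorph0 !horner0.
rewrite rmorphD rmorphM /= wsubX wsubC !hornerD !hornerM IH !hornerX !hornerC.
congr (_ * _ + _).
  by rewrite hornerD hornerM !hornerC hornerXn expr0n gtn_eqF // mulr0 addr0 hornerC.
elim/poly_ind: c {p IH} => [|c d IH]; first by rewrite rmorph0 !horner0.
rewrite rmorphD rmorphM /= map_polyX map_polyC !hornerD !hornerM !hornerX !hornerC IH.
by rewrite hornerD hornerC hornerXn expr0n gtn_eqF // addr0 hornerC.
Qed.

(* The Newton polygon of W at (x0, y0) is the segment from (a, 0) to (0, b): as a and b are coprime it has no interior lattice point, hence a factor vanishing at the point accounts for all of it. *)
Lemma newton_segment (G H w : {poly {poly K}}) (c0 c1 : K) :
  coprime a b -> wsub (G * H) = 'X^(a * b) * w ->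
  w`_0 = c1 *: 'X^a + c0%:P -> c0 != 0 -> c1 != 0 ->
  G.[x0%:P].[y0] != 0 \/ H.[x0%:P].[y0] != 0.
Proof.
move=> cop e w0 nc0 nc1.
have sw : size w`_0 = a.+1.
  rewrite w0 size_polyDl size_scale // size_polyXn // size_polyC.
  by rewrite ltnS (leq_trans (leq_b1 _)).
have wn0 : w`_0 != 0 by rewrite -size_poly_eq0 sw.
rewrite rmorphM in e.
have [n1 [n2 [g [h [en eG eH e0]]]]] := mul_polyXn_split e wn0.
have wg i : g`_0`_i != 0 -> exists j, n1 = (b * i + a * j)%N.
  by move=> gi; apply: (@wexpo_wsub G); rewrite eG coefXnM ltnn subnn.
have wh i : h`_0`_i != 0 -> exists j, n2 = (b * i + a * j)%N.
  by move=> hi; apply: (@wexpo_wsub H); rewrite eH coefXnM ltnn subnn.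
have : g`_0`_0 * h`_0`_0 = c0.
  by rewrite -coef0M e0 w0 coefD coefZ coefXn coefC eqxx ltn_eqF //= mulr0 add0r.
move=> e00; move: nc0; rewrite -e00 mulf_eq0 negb_or => /andP[g00 h00].
have gn0 : g`_0 != 0 by apply: contraNneq g00 => ->; rewrite coef0.
have hn0 : h`_0 != 0 by apply: contraNneq h00 => ->; rewrite coef0.
have [j1] := wg _ g00; have [j2] := wh _ h00.
have [k1] := wg (size g`_0).-1 (etrans (congr1 negb (lead_coef_eq0 _)) gn0).
have [k2] := wh (size h`_0).-1 (etrans (congr1 negb (lead_coef_eq0 _)) hn0).
move: sw; rewrite -e0 size_mul // => sw.
move: (size_poly_eq0 g`_0) (size_poly_eq0 h`_0).
rewrite (negPf gn0) (negPf hn0).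
move: (size g`_0) (size h`_0) sw => [//|i1] [//|i2] /=; rewrite addnS /= => -[ei] _ _.
rewrite !muln0 !add0n => eq1 eq2 eq3 eq4.
(* Here [i1] and [i2] are the S-degrees of the two initial parts, with sum [a]. The leading terms
   give [n1 >= b * i1] and [n2 >= b * i2], and [n1 + n2 = a * b] forces equality; the constant terms
   make [n1] equal to [a * j1]. *)
have e5 : (b * i1 = a * j1)%N by nia.
have : (a %| i1)%N by rewrite -(Gauss_dvdr _ cop) e5 dvdn_mulr.
case/dvdnP => -[|u] eu.
  left; rewrite -wsub_coef00 eG.
  have -> : n1 = 0%N by nia.
  by rewrite expr0 mul1r.
right; rewrite -wsub_coef00 eH.
have -> : n2 = 0%N by nia.
by rewrite expr0 mul1r.
Qed.
End WeightedSubstitution.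

(** * Dickson invariants *)

Section Dickson.
Variable q : nat.

Definition dicksonL (S : comNzRingType) (y z : S) : S := y ^+ q * z - y * z ^+ q.

(* The Dickson invariant (y^(q^2) z - y z^(q^2)) / (y^q z - y z^q). *)
Definition dicksonQ (S : comNzRingType) (y z : S) : S :=
  \sum_(i < q.+1) (y ^+ q.-1) ^+ (q - i) * (z ^+ q.-1) ^+ i.

(* The product of x + b y + c z over b, c in F_q. *)
Definition orbitV (S : comNzRingType) (x y z : S) : S :=
  x ^+ (q ^ 2) - dicksonQ y z * x ^+ q + dicksonL y z ^+ q.-1 * x.

Definition curve1 (S : comNzRingType) (x y z : S) : S :=
  orbitV x y z ^+ q.-1 + dicksonQ y z ^+ q.

Definition curve2 (S : comNzRingType) (x y z : S) : S :=
  orbitV x y z ^+ q.-1 * dicksonQ y z + dicksonL y z ^+ (q * q.-1).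

Lemma rmorph_dicksonL (S T : comNzRingType) (h : {rmorphism S -> T}) y z :
  h (dicksonL y z) = dicksonL (h y) (h z).
Proof. by rewrite /dicksonL rmorphB !rmorphM !rmorphXn. Qed.

Lemma rmorph_dicksonQ (S T : comNzRingType) (h : {rmorphism S -> T}) y z :
  h (dicksonQ y z) = dicksonQ (h y) (h z).
Proof.
rewrite /dicksonQ rmorph_sum; apply: eq_bigr => i _.
by rewrite rmorphM !rmorphXn.
Qed.

Lemma rmorph_orbitV (S T : comNzRingType) (h : {rmorphism S -> T}) x y z :
  h (orbitV x y z) = orbitV (h x) (h y) (h z).
Proof.
rewrite /orbitV rmorphD rmorphB !rmorphM !rmorphXn.
by rewrite rmorph_dicksonL rmorph_dicksonQ.
Qed.

Lemma rmorph_curve1 (S T : comNzRingType) (h : {rmorphism S -> T}) x y z :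
  h (curve1 x y z) = curve1 (h x) (h y) (h z).
Proof. by rewrite /curve1 rmorphD !rmorphXn rmorph_orbitV rmorph_dicksonQ. Qed.

Lemma rmorph_curve2 (S T : comNzRingType) (h : {rmorphism S -> T}) x y z :
  h (curve2 x y z) = curve2 (h x) (h y) (h z).
Proof.
rewrite /curve2 rmorphD rmorphM !rmorphXn.
by rewrite rmorph_orbitV rmorph_dicksonQ rmorph_dicksonL.
Qed.

Hypothesis q0 : (0 < q)%N.

Lemma dicksonQL (S : comNzRingType) (y z : S) :
  dicksonQ y z * dicksonL y z = y ^+ (q ^ 2) * z - y * z ^+ (q ^ 2).
Proof.
have e1 (a b : S) n : (0 < n)%N -> a ^+ n * b - a * b ^+ n = a * b * (a ^+ n.-1 - b ^+ n.-1).
  by case: n => // n _; rewrite !exprS /=; ring.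
rewrite /dicksonL !e1 ?expn_gt0 ?q0 // mulrCA; congr (_ * _).
have -> : ((q ^ 2).-1 = q.-1 * q.+1)%N by rewrite -mulnn; case: (q) q0 => // r _; lia.
by rewrite mulrC /dicksonQ !exprM [RHS]subrXX.
Qed.

Section Invariance.
Variable S : idomainType.
Hypothesis frob : forall a b : S, (a + b) ^+ q = a ^+ q + b ^+ q.

Let frob2 (a b : S) : (a + b) ^+ (q ^ 2) = a ^+ (q ^ 2) + b ^+ (q ^ 2).
Proof. by rewrite -mulnn !exprM !frob. Qed.

Lemma orbitVD (x x' y z : S) : orbitV (x + x') y z = orbitV x y z + orbitV x' y z.
Proof. by rewrite /orbitV frob frob2; ring. Qed.

Lemma orbitVMl (a x y z : S) : a ^+ q = a -> orbitV (a * x) y z = a * orbitV x y z.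
Proof.
by move=> aq; rewrite /orbitV !exprMn -mulnn !exprM !aq; ring.
Qed.

(** After multiplication by [L], the middle term becomes explicit through [dicksonQL] and the last
    one becomes [L^q * y], which Frobenius expands; everything cancels. *)
Lemma orbitV_eq0l (y z : S) : dicksonL y z != 0 -> orbitV y y z = 0.
Proof.
move=> L0; apply: (mulfI L0); rewrite mulr0 /orbitV mulrDr mulrBr mulrA.
rewrite [_ * dicksonQ y z]mulrC dicksonQL mulrA -exprS prednK //.
have -> : dicksonL y z ^+ q = y ^+ (q ^ 2) * z ^+ q - y ^+ q * z ^+ (q ^ 2).
  have opq (a : S) : (- a) ^+ q = - (a ^+ q).
    by apply/eqP; rewrite -subr_eq0 opprK -frob addNr expr0n gtn_eqF.
  by rewrite /dicksonL frob opq !exprMn -mulnn !exprM.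
by rewrite /dicksonL; ring.
Qed.

Lemma dicksonL_opp (y z : S) : dicksonL z y = - dicksonL y z.
Proof. by rewrite /dicksonL; ring. Qed.

Lemma dicksonQ_sym (y z : S) : dicksonL y z != 0 -> dicksonQ z y = dicksonQ y z.
Proof.
move=> L0; apply: (mulIf L0); rewrite dicksonQL.
by apply: oppr_inj; rewrite -mulrN -dicksonL_opp dicksonQL; ring.
Qed.

Section Linear.
Variables a b c d : S.
Hypotheses (aq : a ^+ q = a) (bq : b ^+ q = b) (cq : c ^+ q = c) (dq : d ^+ q = d).
Let D := a * d - b * c.
Hypothesis D0 : D != 0.

Let qq (u : S) : u ^+ q = u -> u ^+ (q ^ 2) = u.
Proof. by move=> uq; rewrite -mulnn exprM !uq. Qed.

Lemma dicksonL_lin y z : dicksonL (a * y + b * z) (c * y + d * z) = D * dicksonL y z.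
Proof. by rewrite /dicksonL !frob !exprMn aq bq cq dq /D; ring. Qed.

(** [L] and the product [Q * L] are both multiplied by the determinant [D], so their quotient is
    invariant. *)
Lemma dicksonQ_lin y z : dicksonL y z != 0 ->
  dicksonQ (a * y + b * z) (c * y + d * z) = dicksonQ y z.
Proof.
move=> L0; apply: (mulIf (mulf_neq0 D0 L0)).
rewrite -dicksonL_lin dicksonQL dicksonL_lin mulrCA dicksonQL.
by rewrite !frob2 !exprMn (qq aq) (qq bq) (qq cq) (qq dq) /D; ring.
Qed.

Let opq (u : S) : (- u) ^+ q = - (u ^+ q).
Proof. by apply/eqP; rewrite -subr_eq0 opprK -frob addNr expr0n gtn_eqF. Qed.

Lemma Fq_exp_pred1 (u : S) : u ^+ q = u -> u != 0 -> u ^+ q.-1 = 1.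
Proof. by move=> uq u0; apply: (mulIf u0); rewrite -exprSr prednK // uq mul1r. Qed.

Lemma dicksonL_lin_pred y z :
  dicksonL (a * y + b * z) (c * y + d * z) ^+ q.-1 = dicksonL y z ^+ q.-1.
Proof.
rewrite dicksonL_lin exprMn Fq_exp_pred1 ?mul1r //.
by rewrite /D frob opq !exprMn aq bq cq dq.
Qed.

Variables e f g : S.
Hypotheses (eq' : e ^+ q = e) (fq : f ^+ q = f) (gq : g ^+ q = g).

(** [Q] and [L^(q-1)] are unchanged by the linear map on (y, z). What remains is F_q-linear in x and
    vanishes at x = y and x = z, so only the term [e * x] contributes. *)
Lemma orbitV_lin x y z : dicksonL y z != 0 ->
  orbitV (f * y + g * z + e * x) (a * y + b * z) (c * y + d * z) = e * orbitV x y z.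
Proof.
move=> L0.
have -> : orbitV (f * y + g * z + e * x) (a * y + b * z) (c * y + d * z) =
  orbitV (f * y + g * z + e * x) y z.
  by rewrite /orbitV dicksonQ_lin // dicksonL_lin_pred.
rewrite !orbitVD !orbitVMl // orbitV_eq0l // mulr0 add0r.
suff -> : orbitV z y z = 0 by rewrite mulr0 add0r.
have L0' : dicksonL z y != 0 by rewrite dicksonL_opp oppr_eq0.
have := orbitV_eq0l L0'; rewrite /orbitV dicksonQ_sym // => <-.
rewrite -dicksonQ_sym // dicksonL_opp; congr (_ - _ + _ * _).
have := @Fq_exp_pred1 (-1); rewrite opq expr1n oppr_eq0 oner_eq0 => /(_ erefl isT) e1.
by rewrite -mulN1r exprMn e1 mul1r.
Qed.

Hypothesis e0 : e != 0.

Lemma curve1_lin x y z : dicksonL y z != 0 ->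
  curve1 (f * y + g * z + e * x) (a * y + b * z) (c * y + d * z) = curve1 x y z.
Proof.
by move=> L0; rewrite /curve1 orbitV_lin // dicksonQ_lin // exprMn Fq_exp_pred1 ?mul1r.
Qed.

Lemma curve2_lin x y z : dicksonL y z != 0 ->
  curve2 (f * y + g * z + e * x) (a * y + b * z) (c * y + d * z) = curve2 x y z.
Proof.
move=> L0; rewrite /curve2 orbitV_lin // dicksonQ_lin // exprMn Fq_exp_pred1 ?mul1r //.
by rewrite mulnC !exprM dicksonL_lin_pred.
Qed.

End Linear.
End Invariance.
End Dickson.

(** * Homogeneous polynomials in three variables *)

Notation i0 := (@Ordinal 3 0 isT).
Notation i1 := (@Ordinal 3 1 isT).
Notation i2 := (@Ordinal 3 2 isT).

Lemma sum3E (V : nmodType) (f : 'I_3 -> V) : \sum_i f i = f i0 + f i1 + f i2.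
Proof.
rewrite !big_ord_recl big_ord0 addr0 addrA.
by congr (f _ + f _ + f _); apply: val_inj.
Qed.

Lemma ord3P (P : 'I_3 -> Prop) : P i0 -> P i1 -> P i2 -> forall i, P i.
Proof.
move=> h0 h1 h2 [[|[|[|m]]] Hm] //.
- by have -> : Ordinal Hm = i0 by apply: val_inj.
- by have -> : Ordinal Hm = i1 by apply: val_inj.
- by have -> : Ordinal Hm = i2 by apply: val_inj.
Qed.

Lemma mdeg3E (m : 'X_{1..3}) : mdeg m = (m i0 + m i1 + m i2)%N.
Proof. by rewrite mdegE sum3E. Qed.

Lemma mnm3P (m m' : 'X_{1..3}) :
  m i0 = m' i0 -> m i1 = m' i1 -> m i2 = m' i2 -> m = m'.
Proof. by move=> h0 h1 h2; apply/mnmP; apply: ord3P. Qed.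

Lemma rmorph_mmap n (R : nzRingType) (S T : comNzRingType) (f : {rmorphism R -> S})
    (g : {rmorphism S -> T}) (v : 'I_n -> S) (p : {mpoly R[n]}) :
  g (mmap f v p) = mmap (g \o f) (g \o v) p.
Proof.
rewrite /mmap rmorph_sum; apply: eq_bigr => m _.
by rewrite rmorphM /mmap1 rmorph_prod; congr (_ * _); apply: eq_bigr => i _; rewrite rmorphXn.
Qed.

Lemma eq_mmap n (R S : nzRingType) (f g : R -> S) (u v : 'I_n -> S) (p : {mpoly R[n]}) :
  f =1 g -> u =1 v -> mmap f u p = mmap g v p.
Proof.
by move=> efg euv; rewrite /mmap; apply: eq_bigr => m _; rewrite efg (mmap1_eq _ euv).
Qed.

Lemma dhomog_mdeg k (R : nzRingType) n (F : {mpoly R[k]}) m :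
  F \is n.-homog -> m \in msupp F -> mdeg m = n.
Proof. by move=> /dhomogP hF /hF. Qed.

Section LinearSubstitution.
Variable K : fieldType.
Implicit Types (A B : 'M[K]_3) (F G H : {mpoly K[3]}).

Lemma mmap_lin_subst (S : comNzRingType) (f : {rmorphism K -> S}) (v : 'I_3 -> S) A F :
  mmap f v (F \mPo lin_subst A) = mmap f (fun i => \sum_j f (A i j) * v j) F.
Proof.
rewrite /comp_mpoly (rmorph_mmap _ (mmap f v)); apply: eq_mmap => [c|i] /=.
  by rewrite mmapC.
rewrite tnth_mktuple rmorph_sum; apply: eq_bigr => j _.
by rewrite [LHS]mmapZ mmapX mmap1U.
Qed.

Lemma lin_subst_comp A B F :
  (F \mPo lin_subst A) \mPo lin_subst B = F \mPo lin_subst (A *m B).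
Proof.
rewrite {1}/comp_mpoly mmap_lin_subst; apply: eq_mmap => // i.
rewrite !tnth_mktuple.
transitivity (\sum_j \sum_k (A i j * B j k) *: ('X_k : {mpoly K[3]})).
  apply: eq_bigr => j _; rewrite tnth_mktuple mulr_sumr; apply: eq_bigr => k _.
  by rewrite mul_mpolyC scalerA.
by rewrite exchange_big; apply: eq_bigr => k _; rewrite mxE scaler_suml.
Qed.

Lemma lin_subst1 F : F \mPo lin_subst 1%:M = F.
Proof.
rewrite -[RHS]comp_mpoly_id; apply: eq_mmap => // i.
rewrite !tnth_mktuple (bigD1 i) //= big1 ?mxE ?eqxx ?scale1r ?addr0 // => j ji.
by rewrite mxE eq_sym (negPf ji) scale0r.
Qed.

Lemma dhomog_lin_subst n A F :
  F \is n.-homog -> F \mPo lin_subst A \is n.-homog.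
Proof.
move=> hF; rewrite comp_mpolyE big_seq; apply: rpred_sum => m mF.
apply: rpredZ; rewrite -(dhomog_mdeg hF mF) mdegE.
have X1 i : tnth (lin_subst A) i \is 1.-homog.
  rewrite tnth_mktuple; apply: rpred_sum => j _; apply: rpredZ.
  by rewrite dhomogX; apply/eqP/mdeg1.
elim/big_ind2: _ => [|d p e r hp hr|i _]; first exact: dhomog1.
  exact: dhomogM.
by rewrite -[in X in _ \is X.-homog](mul1n (m i)); exact: dhomogMn.
Qed.

Lemma msize_le1_lin_subst A F : A \in unitmx ->
  (msize (F \mPo lin_subst A) <= 1)%N -> (msize F <= 1)%N.
Proof.
move=> uA /msize1_polyC e.
rewrite -(lin_subst1 F) -(mulmxV uA) -lin_subst_comp e comp_mpolyC msizeC.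
exact: leq_b1.
Qed.

Lemma mirreducible_lin_subst A F : A \in unitmx ->
  mirreducible F -> mirreducible (F \mPo lin_subst A).
Proof.
move=> uA [s1 irr]; split.
  by rewrite ltnNge; apply/negP => /(msize_le1_lin_subst uA); rewrite leqNgt s1.
move=> G H e.
have : F = (G \mPo lin_subst (invmx A)) * (H \mPo lin_subst (invmx A)).
  by rewrite -rmorphM /= -e lin_subst_comp mulmxV // lin_subst1.
have uA' : invmx A \in unitmx by rewrite unitmx_inv.
by case/irr => /(msize_le1_lin_subst uA'); [left | right].
Qed.

End LinearSubstitution.

Section Homogeneous.
Variable K : fieldType.
Implicit Types (F G H : {mpoly K[3]}).

Lemma mpolyX_dvd k (i : 'I_k) (F : {mpoly K[k]}) :
  {in msupp F, forall m : 'X_{1..k}, (0 < m i)%N} -> exists G : {mpoly K[k]}, F = 'X_i * G.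
Proof.
move=> h; exists (\sum_(m <- msupp F) F@_m *: 'X_[m - U_(i)]).
rewrite mulr_sumr [LHS]mpolyE big_seq [RHS]big_seq; apply: eq_bigr => m mF.
rewrite -scalerAr -mpolyXD addmC submK //.
apply/mnm_lepP => j; rewrite mnm1E; case: eqP => // <-; exact: h.
Qed.

Lemma msize_dhomog k n (F : {mpoly K[k]}) : F != 0 -> F \is n.-homog -> msize F = n.+1.
Proof.
move=> F0 hF; rewrite (mpolySpred _ F0) -/(msize F); congr _.+1.
by apply: (dhomog_uniq F0 _ hF); apply: dhomog_msize hF.
Qed.

Lemma mirreducible_neq0 F : mirreducible F -> F != 0.
Proof. by case=> s _; apply: contraTneq s => ->; rewrite msize0. Qed.

(** Otherwise the line ['X_i = 0] would be a component of a curve of degree at least 2. The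
    monomials found this way serve later to pin down the scalars of semi-invariance. *)
Lemma mirreducible_support n F i :
  (2 <= n)%N -> F \is n.-homog -> mirreducible F ->
  exists2 m, m \in msupp F & m i = 0%N.
Proof.
move=> n2 hF irr; have F0 := mirreducible_neq0 irr.
have [/hasP[m mF /eqP mi]|/hasPn h] := boolP (has (fun m : 'X_{1..3} => m i == 0%N) (msupp F)).
  by exists m.
have [|G e] := @mpolyX_dvd 3 i F; first by move=> m /h; rewrite lt0n.
have G0 : G != 0 by apply: contraNneq F0 => G0; rewrite e G0 mulr0.
have X0 : 'X_i != 0 :> {mpoly K[3]}.
  by rewrite -msize_poly_eq0 msizeX.
have sF := msize_dhomog F0 hF.
move: sF; rewrite {1}e msizeM // msizeX mdeg1 /= add1n => -[sG].
by case: irr => _ /(_ _ _ e) []; rewrite ?msizeX ?mdeg1 // sG; lia.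
Qed.

Lemma mul_eq_monomial (R : idomainType) (p r : {poly R}) (c : R) n :
  c != 0 -> p * r = c *: 'X^n -> exists i a, p = a *: 'X^i.
Proof.
move=> c0 e; have e' : p * r = 'X^n * c%:P by rewrite e mulrC mul_polyC.
have [|n1 [n2 [p' [r' [en ep er _]]]]] := mul_polyXn_split e'.
  by rewrite coefC eqxx.
have e2 : p' * r' = c%:P.
  have Xn0 : 'X^n != 0 :> {poly R} by rewrite -size_poly_eq0 size_polyXn.
  apply: (mulfI Xn0); rewrite -e' ep er -en exprD; ring.
have /eqP : size (p' * r') = 1%N by rewrite e2 size_polyC c0.
rewrite size_mul_eq1 => /andP[/eqP s1 _].
by exists n1, p'`_0; rewrite ep (size1_polyC (eq_leq s1)) coefC mulrC mul_polyC.
Qed.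

(** The substitution [F(tX)], which puts the degree d part of [F] in front of [t^d]. *)
Definition grade : {mpoly K[3]} -> {poly {mpoly K[3]}} :=
  mmap (polyC \o mpolyC 3 (R := K)) (fun i => 'X_i *: 'X).

HB.instance Definition _ := GRing.RMorphism.on grade.

Lemma coef_grade F d : (grade F)`_d = pihomog mdeg d F.
Proof.
rewrite pihomogE /grade /mmap coef_sum [RHS]big_mkcond; apply: eq_bigr => m _.
have -> : mmap1 (fun i => 'X_i *: 'X) m = 'X_[m] *: 'X^(mdeg m) :> {poly {mpoly K[3]}}.
  rewrite /mmap1 mpolyXE_id mdegE.
  elim/big_rec3: _ => [|i a b c _ ->]; first by rewrite expr0 scale1r.
  by rewrite exprZn exprD -scalerAl -scalerAr scalerA.
rewrite /= coefCM coefZ coefXn eq_sym mul_mpolyC.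
by case: eqP => _; rewrite ?mulr1 ?mulr0 ?scaler0.
Qed.

Lemma dhomog_grade F n : F \is n.-homog -> grade F = F *: 'X^n.
Proof.
move=> hF; apply/polyP => d; rewrite coef_grade coefZ coefXn.
case: eqP => [->|/eqP dn]; first by rewrite pihomog_dE // mulr1.
by rewrite mulr0 (@pihomog_ne0 _ _ _ n) // eq_sym.
Qed.

(** The product of the two grades is a monomial in t, so each grade is a monomial, and only one
    homogeneous part of [G] survives. *)
Lemma dhomog_factor F G H n : F != 0 -> F \is n.-homog -> F = G * H ->
  exists d, G \is d.-homog.
Proof.
move=> F0 hF e.
have : grade G * grade H = F *: 'X^n by rewrite -rmorphM /= -e (dhomog_grade hF).
case/(mul_eq_monomial F0) => i [a ei]; exists i.
rewrite (@pihomog_partitionE _ _ mdeg (msize G) G) //; apply: rpred_sum => d _.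
have [->|di] := eqVneq (d : nat) i; first exact: pihomogP.
by rewrite -coef_grade ei coefZ coefXn (negPf di) mulr0 rpred0.
Qed.

End Homogeneous.

Section Dehomogenization.
Variable K : fieldType.
Implicit Types (F G H : {mpoly K[3]}).

(** The chart z = 1: the first coordinate y becomes the inner variable, the last coordinate x the
    outer one. *)
Definition chart (i : 'I_3) : {poly {poly K}} := tnth [tuple 'X%:P; 1; 'X] i.

Definition dehom : {mpoly K[3]} -> {poly {poly K}} := mmap (polyC \o polyC) chart.

HB.instance Definition _ := GRing.RMorphism.on dehom.

Lemma coef_dehom F i j :
  (dehom F)`_i`_j = \sum_(m <- msupp F) F@_m * ((m i2 == i) && (m i0 == j))%:R.
Proof.
rewrite /dehom /mmap !coef_sum; apply: eq_bigr => m _.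
have -> : mmap1 chart m = 'X%:P ^+ m i0 * 'X ^+ m i2.
  rewrite /mmap1 !big_ord_recl big_ord0 mulr1 /chart /=.
  rewrite /tnth /= expr1n mul1r.
  by congr (_ ^+ m _ * _ ^+ m _); apply: val_inj.
rewrite /= mulrA -rmorphXn -rmorphM /= coefCM coefXn eq_sym.
case: eqP => _; last by rewrite mulr0 coef0 mulr0.
by rewrite mulr1 coefCM coefXn eq_sym.
Qed.

(** The total degree and the exponents of x and y determine that of z, so no two monomials of a
    homogeneous polynomial collide in the chart. *)
Lemma coef_dehom_mdeg n F m : F \is n.-homog -> mdeg m = n ->
  (dehom F)`_(m i2)`_(m i0) = F@_m.
Proof.
move=> hF dm; rewrite coef_dehom.
have z m' : m' \in msupp F -> m' != m ->
    F@_m' * ((m' i2 == m i2) && (m' i0 == m i0))%:R = 0.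
  move=> mF'; have [/andP[/eqP e2 /eqP e0]|] := boolP (_ && _); last by rewrite mulr0.
  have := dhomog_mdeg hF mF'; rewrite -dm !mdeg3E e0 e2 => e1.
  by case/eqP; apply: mnm3P => //; lia.
have [mF|mF] := boolP (m \in msupp F).
  rewrite (bigD1_seq m) ?msupp_uniq //= !eqxx mulr1 big_seq_cond big1 ?addr0 //.
  by move=> m' /andP[]; exact: z.
rewrite big_seq big1 => [|m' mF']; first by move: mF; rewrite -mcoeff_eq0 => /eqP.
by apply: z => //; apply: contraNneq mF => <-.
Qed.

Lemma coef_dehom_neq0 n F i j : F \is n.-homog -> (dehom F)`_i`_j != 0 ->
  exists m, [/\ m \in msupp F, mdeg m = n, m i2 = i & m i0 = j].
Proof.
move=> hF; rewrite coef_dehom => n0.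
have /hasP[m mF /andP[/eqP e2 /eqP e0]] :
    has (fun m : 'X_{1..3} => (m i2 == i) && (m i0 == j)) (msupp F).
  apply: contraNT n0 => /hasPn h; rewrite big_seq big1 // => m /h /negPf ->.
  by rewrite mulr0.
by exists m; split=> //; exact: dhomog_mdeg hF mF.
Qed.

(* The last hypothesis only excludes the line z = 0 at infinity of the chart as a component. *)
Lemma mirreducible_dehom n F (S : comNzRingType) (f : {rmorphism K -> S}) (v : 'I_3 -> S) :
  F \is n.-homog -> (0 < n)%N ->
  (forall g h, dehom F = g * h ->
     (exists c : K, g = c%:P%:P) \/ (exists c : K, h = c%:P%:P)) ->
  v i1 = 0 -> mmap f v F != 0 -> mirreducible F.
Proof.
move=> hF n0 irr v1 vF.
have F0 : F != 0 by apply: contraNneq vF => ->; rewrite rmorph0.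
have key G H : F = G * H -> (exists c, dehom G = c%:P%:P) -> (msize G <= 1)%N.
  move=> e [c ec]; have [d hG] := dhomog_factor F0 hF e.
  have G0 : G != 0 by apply: contraNneq F0 => G0; rewrite e G0 mul0r.
  (* A homogeneous factor with constant dehomogenization is a multiple of a power of z; a positive
     power would make [F] vanish under the specialization [v], which sends z to 0. *)
  have suppG m : m \in msupp G -> m i1 = d.
    move=> mG; have dm := dhomog_mdeg hG mG.
    have := coef_dehom_mdeg hG dm; rewrite ec coefC.
    move: mG; rewrite mcoeff_msupp => mG.
    case: eqP => e2; last by rewrite coef0 => /esym /eqP; rewrite (negPf mG).
    rewrite coefC; case: eqP => e0; last by move=> /esym /eqP; rewrite (negPf mG).
    by move: dm; rewrite mdeg3E e0 e2 add0n addn0.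
  case: d hG suppG => [|d] hG suppG; first by rewrite (msize_dhomog G0 hG).
  have [|G' eG] := @mpolyX_dvd K 3 i1 G; first by move=> m /suppG ->.
  by case/eqP: vF; rewrite e eG !rmorphM /= mmapX mmap1U v1 !mul0r.
split; first by rewrite (msize_dhomog F0 hF).
move=> G H e; have := irr (dehom G) (dehom H); rewrite -rmorphM -e => /(_ erefl).
by case=> [/(key G H e)|/(key H G)]; [left | right; rewrite mulrC in e; auto].
Qed.

Lemma dehom_lin_subst A F : dehom (F \mPo lin_subst A) =
  mmap (polyC \o polyC) (fun i => (A i i0)%:P%:P * 'X%:P + (A i i1)%:P%:P + (A i i2)%:P%:P * 'X) F.
Proof.
rewrite /dehom mmap_lin_subst; apply: eq_mmap => // i.
by rewrite sum3E /chart /tnth /= mulr1.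
Qed.

End Dehomogenization.

(** * The affine chart z = 1 *)

Lemma exprD_pchar (S : comNzRingType) (p k : nat) (a b : S) :
  p \in [pchar S] -> (a + b) ^+ (p ^ k) = a ^+ (p ^ k) + b ^+ (p ^ k).
Proof.
move=> ch; apply: exprDn_pchar; by rewrite pnatX pnatE ?(pcharf_prime ch) // ch.

Qed.

(** Translation keeps the leading coefficient, so the scalar can only be 1. *)
Lemma translate_scale_eq1 (R : idomainType) (f : {poly R}) (b c : R) :
  f != 0 -> f \Po ('X + b%:P) = c *: f -> f \Po ('X + b%:P) = f.
Proof.
move=> f0 e; have := congr1 lead_coef e.
rewrite lead_coef_comp ?size_XaddC // lead_coefDl ?size_polyX ?size_polyC ?ltnS ?leq_b1 //.
rewrite lead_coefX expr1n mulr1 lead_coefZ => /esym/eqP.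
rewrite -[X in _ == X]mul1r (inj_eq (mulIf _)) ?lead_coef_eq0 // => /eqP c1.
by rewrite e c1 scale1r.
Qed.

Lemma dilate_lead_coef (R : idomainType) (f : {poly R}) (d : R) :
  d != 0 -> f != 0 -> f \Po (d *: 'X) = f -> d ^+ (size f).-1 = 1.
Proof.
move=> d0 f0 e; have := congr1 lead_coef e.
rewrite lead_coef_comp ?size_scale ?size_polyX // lead_coefZ lead_coefX mulr1.
by rewrite -[RHS]mulr1 => /mulfI -> //; rewrite lead_coef_eq0.
Qed.

Section FiniteField.
Variables (K : closedFieldType) (p k : nat).
Hypotheses (chp : p \in [pchar K]) (k0 : (0 < k)%N).
Local Notation q := (p ^ k)%N.

Lemma q_gt1 : (1 < q)%N.
Proof. by rewrite -(exp1n k) ltn_exp2r // prime_gt1 // (pcharf_prime chp). Qed.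

Lemma natr_q (S : nzRingType) : p \in [pchar S] -> q%:R = 0 :> S.
Proof.
move=> ch; apply/eqP; rewrite -(dvdn_pcharf ch).
by rewrite -(prednK k0) expnS dvdn_mulr.
Qed.

Lemma Fq_enum : exists rs : seq K,
  [/\ uniq rs, size rs = q, 'X^q - 'X = \prod_(r <- rs) ('X - r%:P)
    & forall x, (x \in rs) = in_Fq q x].
Proof.
have q1 := q_gt1.
have sP : size ('X^q - 'X : {poly K}) = q.+1.
  by rewrite size_polyDl ?size_polyXn // size_polyN size_polyX.
have mP : 'X^q - 'X \is @monic K.
  by rewrite monicE lead_coefDl ?lead_coefXn // size_polyN size_polyX size_polyXn.
have [rs] := closed_field_poly_normal ('X^q - 'X : {poly K}).
rewrite (eqP mP) scale1r => e; exists rs; split=> //.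
- rewrite -separable_prod_XsubC -e unlock.
  rewrite derivB derivXn derivX -scaler_nat natr_q // scale0r sub0r.
  by rewrite -(scaleN1r (1 : {poly K})) coprimepZr ?coprimep1 // oppr_eq0 oner_eq0.
- by move/(congr1 (fun P : {poly K} => size P)): e; rewrite sP size_prod_XsubC => -[].
- by move=> x; rewrite -root_prod_XsubC -e rootE !hornerE subr_eq0.
Qed.

Lemma Fq_prim_root : exists d : K, q.-1.-primitive_root d.
Proof.
have q1 := q_gt1; have [rs [u s _ h]] := Fq_enum.
have : has q.-1.-primitive_root (rem 0 rs).
  apply: has_prim_root; first by lia.
  - apply/allP => x; rewrite mem_rem_uniq // inE h /in_Fq => /andP[x0 /eqP xq].
    rewrite unity_rootE; apply/eqP; apply: Fq_exp_pred1 => //; lia.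
  - by rewrite rem_uniq.
  - by rewrite size_rem ?s // h /in_Fq expr0n gtn_eqF //; lia.
by case/hasP => d _ hd; exists d.
Qed.

Lemma prim_root_Fq (d : K) : q.-1.-primitive_root d -> d ^+ q = d.
Proof.
move=> /prim_expr_order h; have q1 := q_gt1.
by rewrite -[in LHS](prednK (ltnW q1)) exprS h mulr1.
Qed.

Let chKYX : p \in [pchar {poly {poly K}}].
Proof. by do 2!apply: (rmorph_pchar (@polyC _)). Qed.

Definition affQ : {poly K} := dicksonQ q 'X 1.
Definition affL : {poly K} := dicksonL q 'X 1.
Definition affV : {poly {poly K}} := orbitV q 'X 'X%:P 1.

Lemma affLE : affL = 'X^q - 'X.
Proof. by rewrite /affL /dicksonL expr1n !mulr1. Qed.

Lemma size_affL : size affL = q.+1.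
Proof. by rewrite affLE size_polyDl ?size_polyXn // size_polyN size_polyX ltnS q_gt1. Qed.

Lemma affL_neq0 : affL != 0.
Proof. by rewrite -size_poly_eq0 size_affL. Qed.

Lemma dicksonL_affE : dicksonL q 'X%:P 1 = affL%:P :> {poly {poly K}}.
Proof. by rewrite /affL (rmorph_dicksonL q (@polyC {poly K})). Qed.

Lemma dicksonQ_affE : dicksonQ q 'X%:P 1 = affQ%:P :> {poly {poly K}}.
Proof. by rewrite /affQ (rmorph_dicksonQ q (@polyC {poly K})). Qed.

Lemma dicksonL_aff_neq0 : dicksonL q 'X%:P 1 != 0 :> {poly {poly K}}.
Proof. by rewrite dicksonL_affE polyC_eq0 affL_neq0. Qed.

Lemma affVE : affV = 'X^(q ^ 2) - affQ%:P * 'X^q + (affL ^+ q.-1)%:P * 'X.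
Proof. by rewrite /affV /orbitV dicksonL_affE dicksonQ_affE -rmorphXn. Qed.

Lemma affV_low_size : (size (- (affQ%:P * 'X^q) + (affL ^+ q.-1)%:P * 'X)%R < (q ^ 2).+1)%N.
Proof.
have q1 := q_gt1; rewrite ltnS.
apply: leq_trans (size_polyD _ _) _; rewrite size_polyN geq_max !mul_polyC.
rewrite !(leq_trans (size_scale_leq _ _)) ?size_polyXn ?size_polyX -?mulnn //; nia.
Qed.

Lemma size_affV : size affV = (q ^ 2).+1.
Proof. by rewrite affVE -addrA size_polyDl size_polyXn // affV_low_size. Qed.

Lemma affV_monic : affV \is monic.
Proof.
by rewrite monicE affVE -addrA lead_coefDl ?lead_coefXn // size_polyXn affV_low_size.
Qed.

Lemma affV_comp (f g e : K) : in_Fq q f -> in_Fq q g -> in_Fq q e ->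
  affV \Po ((f *: 'X + g%:P)%:P + e%:P *: 'X) = e%:P *: affV.
Proof.
move=> /eqP fq /eqP gq /eqP eq'; have q0 := ltnW q_gt1.
rewrite {1}/affV (rmorph_orbitV q (comp_poly _)) /= comp_polyX comp_polyC rmorph1.
have := @orbitV_lin q q0 {poly {poly K}} (fun a b => exprD_pchar k a b chKYX) 1 0 0 1.
rewrite mul0r subr0 mul1r oner_eq0 !expr1n expr0n gtn_eqF //.
move/(_ erefl erefl erefl erefl isT e%:P%:P f%:P%:P g%:P%:P).
rewrite -!rmorphXn /= fq gq eq' => /(_ erefl erefl erefl 'X _ _ dicksonL_aff_neq0).
rewrite !mul1r !mul0r mulr1 addr0 add0r => e1.
by rewrite -[RHS]mul_polyC -[RHS]e1 rmorphD /= -!mul_polyC rmorphM.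
Qed.

Lemma affV_translate (f g : K) : in_Fq q f -> in_Fq q g ->
  affV \Po ('X + (f *: 'X + g%:P)%:P) = affV.
Proof.
move=> fq gq; have : in_Fq q (1 : K) by rewrite /in_Fq expr1n.
by move/(affV_comp fq gq); rewrite polyC1 !scale1r addrC.
Qed.

Definition Fq_lines (rs : seq K) : seq {poly K} :=
  [seq f *: 'X + g%:P | f <- rs, g <- rs].

(** This is [translation_invariant_comp] over the ring [K[y]]: the q^2 linear forms [f y + g] are
    the roots of [V] as a polynomial in x. *)
Lemma comp_affV (rs : seq K) : uniq rs -> size rs = q ->
  (forall x, (x \in rs) = in_Fq q x) ->
  forall f, {in Fq_lines rs, forall b, f \Po ('X + b%:P) = f} -> exists g, f = g \Po affV.
Proof.
move=> urs srs mrs; have q1 := q_gt1.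
have sB : size (Fq_lines rs) = (q ^ 2)%N by rewrite size_allpairs srs mulnn.
have tV : {in Fq_lines rs, forall b, affV \Po ('X + b%:P) = affV}.
  by move=> b /allpairsP[[f g] [/= fr gr ->]]; apply: affV_translate; rewrite -mrs.
apply: translation_invariant_comp => //.
- exact: affV_monic.
- apply: allpairs_uniq => // -[f g] [f' g'] _ _ /= e.
  have := congr1 (fun P : {poly K} => P`_0) e; have := congr1 (fun P : {poly K} => P`_1) e.
  by rewrite !coefD !coefZ !coefC !coefX /= !mulr1 !mulr0 !addr0 !add0r => -> ->.
- by rewrite size_affV sB.
- by rewrite sB expn_gt0 (ltnW q1).
- move=> b bB; have := tV b bB; move/(congr1 (fun P : {poly {poly K}} => P.[0])).
  have -> : (affV \Po ('X + b%:P)).[0] = affV.[b].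
    by rewrite horner_comp; congr (_.[_]); rewrite hornerD hornerX hornerC add0r.
  rewrite rootE => ->; rewrite affVE.
  rewrite !hornerD hornerN !hornerM hornerX !hornerXn !expr0n -mulnn muln_eq0.
  by rewrite gtn_eqF ?(ltnW q1) // !mulr0 subr0 addr0.
Qed.

End FiniteField.

(** * Lower bounds for the degree *)

(* The point is (0 : 0 : 1); in the coordinates (y, z, x) = ('X_i0, 'X_i1, 'X_i2) its stabilizer acts by y -> a y + b z, z -> c y + d z, x -> f y + g z + e x. *)
Definition stab_mx (K : nzRingType) (a b c d f g e : K) : 'M[K]_3 :=
  \matrix_(i, j) nth 0 (nth [::] [:: [:: a; b; 0]; [:: c; d; 0]; [:: f; g; e]] i) j.

Lemma det_stab (K : comNzRingType) (A : 'M[K]_3) : A i0 i2 = 0 -> A i1 i2 = 0 ->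
  \det A = A i2 i2 * (A i0 i0 * A i1 i1 - A i0 i1 * A i1 i0).
Proof.
move=> A02 A12; rewrite (expand_det_col A i2) sum3E A02 A12 !mul0r !add0r.
rewrite /cofactor /= addnn -signr_odd odd_double expr0 mul1r; congr (_ * _).
rewrite (expand_det_row _ ord0) !big_ord_recl big_ord0 /cofactor !det_mx11 !mxE /=.
rewrite addr0 expr0 mul1r expr1 mulN1r mulrN.
by congr (A _ _ * A _ _ - A _ _ * A _ _); apply: val_inj.
Qed.

Lemma stab_mx_unit (K : fieldType) (a b c d f g e : K) :
  (stab_mx a b c d f g e \in unitmx) = ((a * d - b * c) * e != 0).
Proof. by rewrite unitmxE det_stab !mxE //= unitfE mulrC. Qed.

Section Dehom.
Variable K : fieldType.
Implicit Types (F : {mpoly K[3]}).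

Lemma dehomZ c F : dehom (c *: F) = c%:P%:P * dehom F.
Proof. by rewrite /dehom mmapZ. Qed.

Lemma dehom_transvection (f g e : K) F :
  dehom (F \mPo lin_subst (stab_mx 1 0 0 1 f g e)) =
  dehom F \Po ((f *: 'X + g%:P)%:P + e%:P *: 'X).
Proof.
rewrite dehom_lin_subst /dehom [RHS](rmorph_mmap _ (comp_poly _)).
apply: eq_mmap => [c|]; first by rewrite /= comp_polyC.
apply: ord3P; rewrite !mxE /chart /tnth /= ?comp_polyC ?comp_polyX ?polyC0 ?polyC1.
- by rewrite mul1r mul0r !addr0.
- by rewrite !mul0r add0r addr0.
- by rewrite rmorphD /= -!mul_polyC rmorphM.
Qed.

Lemma dehom_base (a b : K) F :
  dehom (F \mPo lin_subst (stab_mx a b 0 1 0 0 1)) =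
  map_poly (comp_poly (a *: 'X + b%:P)) (dehom F).
Proof.
rewrite dehom_lin_subst /dehom [RHS](rmorph_mmap _ (map_poly (comp_poly _))).
apply: eq_mmap => [c|]; first by rewrite /= map_polyC /= comp_polyC.
apply: ord3P; rewrite !mxE /chart /tnth /= ?map_polyC ?map_polyX /= ?comp_polyC ?comp_polyX ?polyC0 ?polyC1.
- by rewrite mul0r addr0 rmorphD /= -mul_polyC rmorphM.
- by rewrite !mul0r add0r addr0.
- by rewrite !mul0r !add0r mul1r.
Qed.

Lemma coef_map_comp (u : {poly K}) (P : {poly {poly K}}) i :
  (map_poly (comp_poly u) P)`_i = P`_i \Po u.
Proof. by rewrite coef_map_id0 //= comp_poly0. Qed.

End Dehom.

(* Otherwise F would be a binary form in y and z, which splits into linear factors. *)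
Lemma mirreducible_dehom_gt1 (K : closedFieldType) n (F : {mpoly K[3]}) :
  (2 <= n)%N -> F \is n.-homog -> mirreducible F -> (1 < size (dehom F))%N.
Proof.
move=> n2 hF irr; rewrite ltnNge; apply/negP => s1.
have nz A i j : A \in unitmx -> (dehom (F \mPo lin_subst A))`_i`_j != 0 ->
    exists m, [/\ m \in msupp (F \mPo lin_subst A), mdeg m = n, m i2 = i & m i0 = j].
  by move=> _; exact: coef_dehom_neq0 (dhomog_lin_subst _ hF).
have e1 := size1_polyC s1; set h := (dehom F)`_0 in e1.
have [sh|/gtn_eqF/negbT sh] := leqP (size h) 1.
  have [m mF m1] := mirreducible_support i1 n2 hF irr.
  have dm := dhomog_mdeg hF mF; have := coef_dehom_mdeg hF dm.
  move: mF dm; rewrite mcoeff_msupp mdeg3E m1 e1 coefC => mF dm.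
  case: eqP => m2; last by rewrite coef0 => /esym/eqP; apply/negP.
  by rewrite (size1_polyC sh) coefC; case: eqP => m0; [lia | move=> /esym/eqP; apply/negP].
(* Moving a root t of [h] to y = 0 makes y divide the whole form, against the existence of a
   monomial free of y. *)
have [t rt] := closed_rootP h sh.
have uA : stab_mx 1 t 0 1 0 0 1 \in unitmx.
  by rewrite stab_mx_unit mulr0 subr0 !mulr1 oner_eq0.
have irrA := mirreducible_lin_subst uA irr.
have hA := dhomog_lin_subst (stab_mx 1 t 0 1 0 0 1) hF.
have [m mF m0] := mirreducible_support i0 n2 hA irrA.
have := coef_dehom_mdeg hA (dhomog_mdeg hA mF); move: mF; rewrite mcoeff_msupp => mF.
rewrite dehom_base coef_map_comp e1 coefC m0.
case: eqP => _; last by rewrite comp_poly0 coef0 => /esym/eqP; apply/negP.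
rewrite -horner_coef0 horner_comp scale1r hornerD hornerX hornerC add0r (eqP rt).
by move=> /esym/eqP; apply/negP.
Qed.

Section LowerBound.
Variables (K : closedFieldType) (p k n : nat) (F : {mpoly K[3]}).
Local Notation q := (p ^ k)%N.
Hypotheses (chp : p \in [pchar K]) (k0 : (0 < k)%N).
Hypotheses (n2 : (2 <= n)%N) (hF : F \is n.-homog) (irrF : mirreducible F).
Hypothesis invF : forall a b c d f g e : K,
  in_Fq q a -> in_Fq q b -> in_Fq q c -> in_Fq q d ->
  in_Fq q f -> in_Fq q g -> in_Fq q e -> (a * d - b * c) * e != 0 ->
  curve_invariant (stab_mx a b c d f g e) F.

Let q1 := q_gt1 chp k0.
Let Fq0 : in_Fq q (0 : K). Proof. by rewrite /in_Fq expr0n gtn_eqF // ltnW. Qed.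
Let Fq1 : in_Fq q (1 : K). Proof. by rewrite /in_Fq expr1n. Qed.
Let P := dehom F.

Let P0 : P != 0.
Proof. by rewrite -size_poly_gt0 ltnW // (mirreducible_dehom_gt1 n2). Qed.

Let transl f g : in_Fq q f -> in_Fq q g ->
  P \Po ('X + (f *: 'X + g%:P)%:P) = P.
Proof.
move=> fq gq.
have [] := invF Fq1 Fq0 Fq0 Fq1 fq gq Fq1; first by rewrite mulr0 subr0 !mulr1 oner_eq0.
move=> c _ /(congr1 (@dehom K)); rewrite dehom_transvection dehomZ mul_polyC.
by rewrite polyC1 scale1r addrC => /translate_scale_eq1; apply.
Qed.

(** x does not divide [F], so [P] has a nonzero value at x = 0, which the dilation fixes; comparing
    values there shows that the scalar of semi-invariance is 1. *)
Let dilate e : in_Fq q e -> e != 0 -> P \Po (e%:P *: 'X) = P.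
Proof.
move=> eq' e0.
have [] := invF Fq1 Fq0 Fq0 Fq1 Fq0 Fq0 eq'.
  by rewrite mulr0 subr0 !mul1r.
move=> c _ /(congr1 (@dehom K)); rewrite dehom_transvection dehomZ mul_polyC.
rewrite scale0r polyC0 add0r add0r => E.
have [m mF m2] := mirreducible_support i2 n2 hF irrF.
have := coef_dehom_mdeg hF (dhomog_mdeg hF mF); rewrite m2 -/P => Pm.
have P00 : P`_0 != 0.
  by apply: contraTneq mF => P00; rewrite -mcoeff_eq0 -Pm P00 coef0.
have := congr1 (fun P : {poly {poly K}} => P.[0]) E.
rewrite horner_comp !hornerZ hornerX mulr0 -!horner_coef0 in P00 *.
move/eqP; rewrite -[X in X == _]mul1r (inj_eq (mulIf P00)) => /eqP c1.
by rewrite E -c1 scale1r.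
Qed.

(** Translations make [P] a polynomial [g] in [V], of x-degree [q^2 * deg g]. A dilation of exact
    order q - 1 forces q - 1 to divide this degree, and q - 1 is coprime to q, so it divides
    [deg g]. *)
Let deg_x : exists2 j, (0 < j)%N & size P = (q ^ 2 * (q.-1 * j)).+1.
Proof.
have [rs [urs srs _ mrs]] := Fq_enum chp k0.
have [|g Pg] := @comp_affV K p k chp k0 rs urs srs mrs P.
  by move=> b /allpairsP[[f g] [/= fr gr ->]]; apply: transl; rewrite -mrs.
have [d pd] := Fq_prim_root chp k0.
have dq := prim_root_Fq chp k0 pd.
have d0 : d != 0.
  apply: contraTneq pd => ->; apply/negP => /prim_expr_order /eqP.
  by rewrite expr0n; move: q1; case: q => [|[|r]] //= _; rewrite eq_sym oner_eq0.
have := dilate_lead_coef _ P0 (dilate _ d0).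
rewrite polyC_eq0 /in_Fq dq eqxx => /(_ d0 isT).
have sP : (size P).-1 = ((size g).-1 * q ^ 2)%N.
  by rewrite Pg size_comp_poly size_affV.
rewrite -rmorphXn => /eqP; rewrite -polyC1 (inj_eq (@polyC_inj _)) => /eqP.
move/eqP; rewrite -(prim_order_dvd pd) sP Gauss_dvdl; last first.
  apply: coprimeXr; rewrite -[in X in coprime _ X](prednK (ltnW q1)).
  exact: coprimenS.
case/dvdnP => j ej; have s1 := mirreducible_dehom_gt1 n2 hF irrF.
exists j; last first.
  by rewrite -(ltn_predK s1) -/P sP ej; congr _.+1; lia.
by rewrite lt0n; apply: contraTneq s1 => j0; rewrite -/P; move: sP; rewrite ej j0; lia.
Qed.

Let a := lead_coef P.
Let r := (size P).-1.

Let a0 : a != 0. Proof. by rewrite lead_coef_eq0. Qed.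

Let size_a : (r + (size a).-1 <= n)%N.
Proof.
have : P`_r`_(size a).-1 != 0 by rewrite -/(lead_coef P) -/(lead_coef _) lead_coef_eq0.
case/(coef_dehom_neq0 hF) => m [_]; rewrite mdeg3E => dm <- <-; lia.
Qed.

Let base_dilate d : in_Fq q d -> d != 0 -> a \Po (d *: 'X) = a.
Proof.
move=> dq d0.
have [] := invF dq Fq0 Fq0 Fq1 Fq0 Fq0 Fq1; first by rewrite mulr0 subr0 !mulr1.
move=> c _ /(congr1 (@dehom K)); rewrite dehom_base dehomZ -/P addr0 => E.
have [m mF m0] := mirreducible_support i0 n2 hF irrF.
have := coef_dehom_mdeg hF (dhomog_mdeg hF mF); rewrite m0 -/P => Pm.
have Pm0 : P`_(m i2)`_0 != 0 by rewrite Pm -mcoeff_msupp.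
have := congr1 (fun P : {poly {poly K}} => P`_(m i2)`_0) E.
rewrite coef_map_comp coefCM coefCM -horner_coef0 horner_comp hornerZ hornerX mulr0.
rewrite horner_coef0 => /eqP; rewrite -[X in X == _]mul1r (inj_eq (mulIf Pm0)) => /eqP c1.
have := congr1 (fun P : {poly {poly K}} => P`_r) E.
by rewrite coef_map_comp coefCM -c1 mul1r.
Qed.

Let base_translate b : in_Fq q b -> a \Po ('X + b%:P) = a.
Proof.
move=> bq.
have [] := invF Fq1 bq Fq0 Fq1 Fq0 Fq0 Fq1; first by rewrite mulr0 subr0 !mulr1 oner_eq0.
move=> c _ /(congr1 (@dehom K)); rewrite dehom_base dehomZ -/P scale1r => E.
have := congr1 (fun P : {poly {poly K}} => P`_r) E.
rewrite coef_map_comp coefCM mul_polyC => /translate_scale_eq1; exact.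
Qed.

(** [a] is invariant under translations by F_q, hence a polynomial in [y^q - y], and the dilations
    of y make its degree in [y^q - y] divisible by q - 1. So [deg a] is a multiple of [q^2 - q]. *)
Let size_a1 : ((size a).-1 < q ^ 2 - q)%N -> (size a <= 1)%N.
Proof.
move=> small.
have [rs [urs srs er mrs]] := Fq_enum chp k0.
have sV : size ('X^q - 'X : {poly K}) = q.+1.
  by rewrite er size_prod_XsubC srs.
have [||||||g ag] := @translation_invariant_comp K ('X^q - 'X) rs _ urs _ _ _ _ a.
- by rewrite er monic_prod_XsubC.
- by rewrite sV srs.
- by rewrite srs ltnW.
- by move=> b bB; rewrite er root_prod_XsubC.
- move=> b; rewrite mrs => /eqP bq; rewrite comp_polyB comp_polyX comp_Xn_poly.
  rewrite (exprD_pchar k _ _ (rmorph_pchar (@polyC K) chp)) -rmorphXn /= bq.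
  by rewrite opprD addrACA subrr addr0.
- by move=> b; rewrite mrs => bq; exact: base_translate.
have [d pd] := Fq_prim_root chp k0.
have dq := prim_root_Fq chp k0 pd.
have d0 : d != 0.
  apply: contraTneq pd => ->; apply/negP => /prim_expr_order /eqP.
  by rewrite expr0n; move: q1; case: q => [|[|s]] //= _; rewrite eq_sym oner_eq0.
have := dilate_lead_coef d0 a0 (base_dilate _ d0).
rewrite /in_Fq dq eqxx => /(_ isT).
have sa : (size a).-1 = ((size g).-1 * q)%N by rewrite ag size_comp_poly sV.
move/eqP; rewrite -(prim_order_dvd pd) sa Gauss_dvdl; last first.
  by rewrite -[in X in coprime _ X](prednK (ltnW q1)); exact: coprimenS.
case/dvdnP => j ej; rewrite -mulnn sa ej in small.
have j0 : j = 0%N by case: j {ej} small => // j; move: q1; case: q => // s _ /=; nia.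
by move: sa; rewrite ej j0; case: (size a) => [|[]].
Qed.

(** If [r < n], the term of [F] in x^r is a constant times [x^r z^(n-r)], which vanishes on z = 0.
    The substitution z -> y + z turns the restriction to z = 0 into the restriction to z = y, where
    this term survives, contradicting invariance. *)
Let n_eq_r : (size a <= 1)%N -> n = r.
Proof.
move=> sa; apply/eqP; rewrite eqn_leq (leq_trans _ size_a) ?leq_addr // andbT leqNgt.
apply/negP => rn.
have [] := invF Fq1 Fq0 Fq1 Fq1 Fq0 Fq0 Fq1.
  by rewrite mul0r subr0 !mulr1 oner_eq0.
pose v (i : 'I_3) : {poly K} := tnth [tuple 1; 0; 'X] i.
move=> c _ /(congr1 (mmap (@polyC K) v)); rewrite mmap_lin_subst mmapZ.
have -> : mmap (@polyC K) (fun i => \sum_j (stab_mx 1 0 1 1 0 0 1 i j)%:P * v j) F =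
    map_poly (horner_eval 1) P.
  rewrite /P /dehom [RHS](rmorph_mmap _ (map_poly (horner_eval 1))).
  apply: eq_mmap => [d|]; first by rewrite /= map_polyC /= /horner_eval hornerC.
  apply: ord3P; rewrite sum3E !mxE /v /chart /tnth /= ?map_polyC ?map_polyX /= /horner_eval ?hornerX ?hornerC ?rmorph1 ?rmorph0.
  - by rewrite !mul0r mulr1 !addr0.
  - by rewrite !mul0r mulr1 mulr0 !addr0.
  - by rewrite !mul0r mul1r !add0r.
move/(congr1 (fun P : {poly K} => P`_r)); rewrite coefCM.
rewrite coef_map_id0; last by rewrite /horner_eval horner0.
rewrite -/(lead_coef P) -/a (size1_polyC sa) /horner_eval hornerC.
suff -> : (mmap polyC v F)`_r = 0.
  move/eqP; rewrite mulr0; apply/negP; apply: contraNneq a0 => z.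
  by rewrite (size1_polyC sa) z.
rewrite /mmap coef_sum big_seq big1 // => m mF; rewrite coefCM.
rewrite /mmap1 !big_ord_recl big_ord0 mulr1 /v /tnth /= expr1n mul1r expr0n.
case: eqP => m1; last by rewrite mul0r coef0 mulr0.
rewrite mul1r coefXn; case: eqP => [m2|]; last by rewrite mulr0.
have m1' : m i1 = 0%N by rewrite -[RHS]m1; congr (m _); apply: val_inj.
have m2' : m i2 = r by rewrite [RHS]m2; congr (m _); apply: val_inj.
have dm := dhomog_mdeg hF mF; have := coef_dehom_mdeg hF dm.
rewrite m2' -/P -/(lead_coef P) -/a (size1_polyC sa) coefC.
case: eqP => m0; last by move=> <-; rewrite mul0r.
by move: dm rn; rewrite mdeg3E m1' m2' m0; lia.
Qed.

Lemma invariant_degree_ge : (q ^ 3 - q ^ 2 <= n)%N.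
Proof.
have [j j0 sP] := deg_x; apply: leq_trans size_a; rewrite /r sP /=.
apply: leq_trans (leq_addr _ _); rewrite (expnD q 2 1) expn1.
by move: q1 j0; case: q => // s _; case: j {sP} => // j _; rewrite /= !expnS expn0; nia.
Qed.

(** As [r] is at least [q^3 - q^2], the difference [n - r] is below [q^2 - q], so [a] is constant
    and n = r = [q^2 (q-1) j]. Here j = 1 gives the lower end of the gap, and j >= 2 exceeds the
    upper one. *)
Lemma invariant_degree_gap : (q ^ 3 - q ^ 2 < n)%N -> (n < q ^ 3 - q)%N -> False.
Proof.
move=> lo hi; have [j j0 sP] := deg_x.
have rE : r = (q ^ 2 * (q.-1 * j))%N by rewrite /r sP.
have sa : (size a <= 1)%N.
  apply: size_a1; have := size_a; rewrite rE.
  move: hi q1 j0; case: q => // s; case: j {sP rE} => // j; rewrite /= !expnS expn0; nia.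
have nr := n_eq_r sa; move: lo hi; rewrite nr rE.
move: q1 j0; case: q => // s; case: j {sP rE} => // -[|j] _ _; rewrite /= !expnS expn0; nia.
Qed.

End LowerBound.

(** * Irreducibility of the two curves *)

Lemma lead_coef_translate (R : idomainType) (f : {poly R}) (u : R) :
  lead_coef (f \Po ('X + u%:P)) = lead_coef f.
Proof.
rewrite lead_coef_comp ?size_XaddC // lead_coefDl ?size_polyX ?size_polyC ?ltnS ?leq_b1 //.
by rewrite lead_coefX expr1n mulr1.
Qed.

Lemma comp_translate (R : comNzRingType) (f : {poly R}) (u v : R) :
  (f \Po ('X + u%:P)) \Po ('X + v%:P) = f \Po ('X + (u + v)%:P).
Proof.
rewrite -comp_polyA comp_polyD comp_polyX comp_polyC polyCD.
by congr (_ \Po _); rewrite -addrA [v%:P + _]addrC.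
Qed.

Lemma horner_map_eval (K : fieldType) (f : {poly {poly K}}) (t x : K) :
  (map_poly (horner_eval t) f).[x] = f.[x%:P].[t].
Proof.
elim/poly_ind: f => [|f c IH]; first by rewrite rmorph0 !horner0.
by rewrite rmorphD rmorphM /= map_polyX map_polyC !hornerMXaddC hornerD hornerM hornerC IH.
Qed.

(* Modulo Y - c the translation by u is trivial, so g and the translate of h stay coprime there; hence g divides its own translate. *)
Lemma coprime_fibre_translate (K : closedFieldType) (f g h : {poly {poly K}})
    (u : {poly K}) (c : K) :
  f = g * h -> f \Po ('X + u%:P) = f -> u.[c] = 0 ->
  (lead_coef g).[c] != 0 -> (lead_coef h).[c] != 0 ->
  (1 < size g)%N -> (1 < size h)%N ->
  (forall x, g.[x%:P].[c] != 0 \/ h.[x%:P].[c] != 0) ->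
  g \Po ('X + u%:P) = g.
Proof.
move=> fE fu uc lg lh sg sh cop.
pose tau (P : {poly {poly K}}) := P \Po ('X + u%:P).
have stau P : size (tau P) = size P by rewrite size_comp_poly2 // size_XaddC.
have ltau P : lead_coef (tau P) = lead_coef P by exact: lead_coef_translate.
pose rho := resultant g (tau h).
have ev_tau P : map_poly (horner_eval c) (tau P) = map_poly (horner_eval c) P.
  by rewrite map_comp_poly rmorphD /= map_polyX map_polyC /= /horner_eval uc addr0 comp_polyXr.
(* The leading coefficients survive at y = c, so the resultant specializes to that of [g] and [h] on
   this fibre, where they have no common root. *)
have rho0 : rho != 0.
  apply: contraTneq isT => rho0; have := congr1 (horner_eval c) rho0.
  rewrite map_resultant ?ltau //= ev_tau rmorph0 => /eqP.
  rewrite resultant_eq0 => /gtn_eqF /negbT /closed_rootP [x].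
  rewrite root_gcd !rootE !horner_map_eval => /andP[/eqP gx /eqP hx].
  by case: (cop x) => /eqP; rewrite ?gx ?hx.
have sth : (1 < size (tau h))%N by rewrite stau.
have [[u1 u2] /= _ e] := resultant_in_ideal sg sth.
(* Multiply the Bezout relation for [rho] by [tau g] and use [tau g * tau h = g * h]. *)
have ek : rho%:P * tau g = g * (u1 * tau g + u2 * h).
  have ff : tau g * tau h = g * h by rewrite -comp_polyM -fE fu.
  transitivity (u1 * g * tau g + u2 * (tau g * tau h)).
    by rewrite /rho e; ring.
  by rewrite ff; ring.
have g0 : g != 0 by rewrite -size_poly_gt0 ltnW.
move: ek; set kk := _ + _ => ek.
have kk0 : kk != 0.
  apply: contraTneq isT => z; move/eqP: ek; rewrite z mulr0 mulf_eq0 polyC_eq0 (negPf rho0) /=.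
  by rewrite -size_poly_eq0 stau size_poly_eq0 (negPf g0).
(* The left side has the x-degree of [g], so the cofactor is free of x; comparing leading
   coefficients then identifies it with [rho]. *)
have sk : size kk = 1%N.
  have := congr1 (fun P : {poly {poly K}} => size P) ek.
  rewrite mul_polyC size_scale // stau size_mul //.
  by move: sg kk0; rewrite -size_poly_gt0; case: (size g) => // s; case: (size kk) => // -[|m] //=; rewrite ?addnS /=; lia.
have ck := size1_polyC (eq_leq sk).
have : rho * lead_coef g = lead_coef g * kk`_0.
  have := congr1 (@lead_coef _) ek.
  by rewrite !lead_coefM lead_coefC ltau {1}ck lead_coefC.
rewrite mulrC => /mulfI; rewrite lead_coef_eq0 => /(_ g0) rk.
have rP0 : rho%:P != 0 by rewrite polyC_eq0.
by apply: (mulfI rP0); rewrite -/(tau g) ek ck -rk mulrC.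
Qed.

Lemma dicksonQ_expand q (S : comNzRingType) (y : S) : (1 < q)%N ->
  exists R, dicksonQ q y 1 = 1 + y ^+ q.-1 + (y ^+ q.-1) ^+ 2 * R.
Proof.
case: q => [|[|q]] // _; set t := y ^+ _.
exists (\sum_(i < q.+1) t ^+ (q - i)).
have -> : dicksonQ q.+2 y 1 = \sum_(i < q.+3) t ^+ (q.+2 - i).
  by apply: eq_bigr => i _; rewrite !expr1n mulr1.
rewrite big_ord_recr big_ord_recr /= subnn subSnn expr0 expr1 addrC addrA addrAC -addrA.
rewrite addrA; congr (_ + _); rewrite mulr_sumr; apply: eq_bigr => i _.
by rewrite -exprD; congr (_ ^+ _); have := ltn_ord i; lia.
Qed.

Lemma exprB1_expand (S : comNzRingType) (t : S) n :
  exists R, (t - 1) ^+ n = (- 1) ^+ n + t * R.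
Proof.
elim: n => [|n [R IH]]; first by exists 0; rewrite !expr0 mulr0 addr0.
by exists ((-1) ^+ n + (t - 1) * R); rewrite !exprS IH; ring.
Qed.

Section Chart.
Variables (K : closedFieldType) (p k : nat).
Hypotheses (chp : p \in [pchar K]) (k0 : (0 < k)%N).
Local Notation q := (p ^ k)%N.
Local Notation affQ := (affQ K p k).
Local Notation affL := (affL K p k).
Local Notation affV := (affV K p k).

Let q1 := q_gt1 chp k0.
Let chKYX : p \in [pchar {poly {poly K}}].
Proof. by do 2!apply: (rmorph_pchar (@polyC _)). Qed.
Let frob (a b : {poly {poly K}}) : (a + b) ^+ q = a ^+ q + b ^+ q.
Proof. exact: exprD_pchar. Qed.

Definition affF1 : {poly {poly K}} := curve1 q 'X 'X%:P 1.
Definition affF2 : {poly {poly K}} := curve2 q 'X 'X%:P 1.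

Lemma affF1E : affF1 = affV ^+ q.-1 + (affQ ^+ q)%:P.
Proof. by rewrite /affF1 /curve1 dicksonQ_affE -rmorphXn. Qed.

Lemma affF2E : affF2 = affV ^+ q.-1 * affQ%:P + (affL ^+ (q * q.-1))%:P.
Proof. by rewrite /affF2 /curve2 dicksonQ_affE dicksonL_affE -rmorphXn. Qed.

Lemma affQL : affQ * affL = 'X^(q ^ 2) - 'X.
Proof. by rewrite dicksonQL ?(ltnW q1) // !expr1n !mulr1. Qed.

Lemma size_affQ_gt1 : (1 < size affQ)%N.
Proof.
have := congr1 (fun P : {poly K} => size P) affQL.
rewrite size_polyDl ?size_polyXn ?size_polyN ?size_polyX; last first.
  by rewrite ltnS -mulnn; nia.
have Q0 : affQ != 0.
  apply: contraTneq isT => z; move: affQL; rewrite z mul0r => /esym/eqP.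
  rewrite -size_poly_eq0 size_polyDl ?size_polyXn // size_polyN size_polyX ltnS.
  by rewrite -mulnn; nia.
rewrite size_mul ?affL_neq0 // size_affL //.
rewrite addnS /= -mulnn.
by move: (size affQ) (q) q1 => m s s1; nia.
Qed.

(** Differentiating [Q * L = y^(q^2) - y] in characteristic p leaves [-1] on the right. So the roots
    of [Q] are simple and [L] is nonzero at them. *)
Lemma affQ_root_simple t : root affQ t -> affQ^`().[t] * affL.[t] = -1.
Proof.
move=> /eqP Qt; have := congr1 (fun P : {poly K} => P^`().[t]) affQL.
rewrite derivM !derivB derivX derivXn hornerD !hornerM Qt mul0r addr0 => ->.
have -> : 'X^((q ^ 2).-1) *+ (q ^ 2) = 0 :> {poly K}.
  by rewrite -mulr_natr -mulnn natrM (natr_q k0 (rmorph_pchar (@polyC K) chp)) !mulr0.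
by rewrite sub0r hornerN hornerC.
Qed.

Lemma affV_at0 : affV.[0] = 0.
Proof.
rewrite affVE !hornerD hornerN !hornerM hornerX !hornerXn !expr0n -mulnn muln_eq0.
by rewrite gtn_eqF ?(ltnW q1) // !mulr0 subr0 addr0.
Qed.

Lemma size_affVX : size (affV ^+ q.-1) = (q ^ 2 * q.-1).+1.
Proof.
have := size_exp affV q.-1; rewrite size_affV //= => <-.
by rewrite prednK // size_poly_gt0 monic_neq0 // monic_exp // affV_monic.
Qed.

Lemma size_affVX_gt1 : (1 < size (affV ^+ q.-1))%N.
Proof. by rewrite size_affVX ltnS muln_gt0 expn_gt0; move: q1; case: q => [|[|s]]. Qed.

Lemma lead_coef_affF2 : lead_coef affF2 = affQ.
Proof.
have s1 := size_affVX_gt1.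
have mV : affV ^+ q.-1 \is monic by rewrite monic_exp // affV_monic.
have Q0 : affQ != 0 by rewrite -size_poly_gt0 (ltnW size_affQ_gt1).
rewrite affF2E lead_coefDl; last first.
  rewrite mulrC mul_polyC size_scale // (leq_ltn_trans _ s1) // size_polyC leq_b1 //.
by rewrite lead_coefM lead_coefC (eqP mV) mul1r.
Qed.

(** A factor free of x divides the leading coefficient [Q]. At one of its roots the value at x = 0
    reduces to a power of [L], which is nonzero at the roots of [Q]. *)
Lemma affF2_factor_vertical (g h : {poly {poly K}}) : affF2 = g * h -> (size g <= 1)%N ->
  exists c : K, g = c%:P%:P.
Proof.
move=> e /size1_polyC gE; set c := g`_0 in gE; exists c`_0; rewrite gE; congr _%:P.
apply: size1_polyC; rewrite leqNgt; apply/negP => /gtn_eqF/negbT/closed_rootP[t rt].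
have Qt : root affQ t.
  by rewrite -lead_coef_affF2 e gE lead_coefM lead_coefC rootM rt.
have : affF2.[0].[t] = 0 by rewrite e gE hornerM hornerC hornerM (eqP rt) mul0r.
rewrite affF2E hornerD hornerM hornerC horner_exp affV_at0 expr0n gtn_eqF; last by lia.
rewrite mul0r add0r hornerC horner_exp => /eqP; rewrite expf_eq0 => /andP[_ /eqP Lt].
by have /eqP := affQ_root_simple Qt; rewrite Lt mulr0 eq_sym oppr_eq0 oner_eq0.
Qed.

(* Over a root t of Q the curve meets the line Y = t only at infinity, and Q divides the leading coefficient exactly once: the Eisenstein criterion in the variable 1/x. *)
Lemma affF2_irreducible (g h : {poly {poly K}}) : affF2 = g * h ->
  (exists c : K, g = c%:P%:P) \/ (exists c : K, h = c%:P%:P).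
Proof.
move=> e.
have [|sg] := leqP (size g) 1; first by move/(affF2_factor_vertical e); left.
have [|sh] := leqP (size h) 1.
  by rewrite mulrC in e; move/(affF2_factor_vertical e); right.
exfalso.
have [t Qt] := closed_rootP affQ (negbT (gtn_eqF size_affQ_gt1)).
have QL := affQ_root_simple Qt.
have Lt : affL.[t] != 0.
  by apply/eqP => z; move/eqP: QL; rewrite z mulr0 eq_sym oppr_eq0 oner_eq0.
pose ev := map_poly (horner_eval t).
have : ev g * ev h = (affL.[t] ^+ (q * q.-1))%:P.
  rewrite -rmorphM /= -e affF2E rmorphD rmorphM /= !map_polyC /= /horner_eval (eqP Qt).
  by rewrite mulr0 add0r horner_exp.
have LX : affL.[t] ^+ (q * q.-1) != 0 by rewrite expf_neq0.
move/(congr1 (fun P : {poly K} => size P)); rewrite size_polyC LX => /eqP.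
rewrite size_mul_eq1 => /andP[/eqP eg /eqP eh].
(* On the fibre y = t the product is a nonzero constant, so both factors reduce to constants and
   both leading coefficients vanish at t; this would make t a double root of [Q]. *)
have vanish (f : {poly {poly K}}) : (1 < size f)%N -> size (ev f) = 1%N -> (lead_coef f).[t] = 0.
  move=> sf ef; have : (ev f)`_(size f).-1 = 0.
    by apply: nth_default; rewrite ef; lia.
  by rewrite coef_map_id0 // /horner_eval horner0.
have := congr1 (fun P : {poly K} => P^`().[t]) lead_coef_affF2.
rewrite e lead_coefM derivM hornerD !hornerM (vanish g) // (vanish h) // mulr0 mul0r addr0.
by move=> z; move/eqP: QL; rewrite -z mul0r eq_sym oppr_eq0 oner_eq0.
Qed.

(** Split [V] additively at x = x0 + S T^(q-1), with y = T^q, t = T^(q(q-1)) and m = x0^q - x0. The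
    part from x0 starts with [m^q - t m], the part from S with [- t S^q]; [C] collects the rest, of
    higher order in T. *)
Lemma wsub_affV_expand (x0 : K) : exists C : {poly {poly K}},
  wsub q q.-1 x0 0 affV = ((x0 ^+ q - x0) ^+ q)%:P%:P +
    'X^(q * q.-1) * ((- (x0 ^+ q - x0)%:P - 'X^q)%:P + 'X * C).
Proof.
have q0 := ltnW q1.
pose T : {poly {poly K}} := 'X; pose X := x0%:P%:P + 'X%:P * T ^+ q.-1.
have e1 : wsub q q.-1 x0 0 affV = orbitV q X (T ^+ q) 1.
  pose h : {rmorphism {poly {poly K}} -> {poly {poly K}}} := wsub q q.-1 x0 0.
  transitivity (orbitV q (h 'X) (h 'X%:P) (h 1)).
    by apply: (@rmorph_orbitV q {poly {poly K}} {poly {poly K}} h).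
  by rewrite rmorph1 /= wsubX wsubC map_polyX hornerX !polyC0 add0r.
have [R eR] := dicksonQ_expand (T ^+ q) q1.
have [R' eR'] := exprB1_expand ((T ^+ q) ^+ q.-1) q.-1.
set t := (T ^+ q) ^+ q.-1 in eR eR'.
have eL : dicksonL q (T ^+ q) 1 ^+ q.-1 = t * (1 + t * R').
  have -> : dicksonL q (T ^+ q) 1 = T ^+ q * (t - 1).
    by rewrite /dicksonL /t expr1n !mulr1 mulrBr mulr1 -exprS prednK.
  rewrite exprMn eR' -/t; congr (_ * (_ + _)).
  apply: Fq_exp_pred1 => //; last by rewrite oppr_eq0 oner_eq0.
  apply/eqP; rewrite -subr_eq0 opprK -[X in _ + X](expr1n _ q) -frob addNr expr0n gtn_eqF //.
have tE : t = 'X^(q * q.-1) by rewrite /t -exprM.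
have [s es] : exists s : nat, (q * q.-1)%N = s.+1.
  by exists (q * q.-1).-1; rewrite prednK // muln_gt0 q0; lia.
have [s' es'] : exists s' : nat, q = s'.+2 by exists q.-2; lia.
rewrite e1 /X orbitVD // /orbitV eR eL !exprMn -!polyC_exp.
have -> : (T ^+ q.-1) ^+ q = t by rewrite /t -!exprM mulnC.
have -> : (T ^+ q.-1) ^+ (q ^ 2) = t * t ^+ s'.+1.
  by rewrite -exprS -es' /t -!exprM -mulnn; congr (_ ^+ _); lia.
have [u tu] : exists u : {poly {poly K}}, t = T * u.
  by exists (T ^+ s); rewrite tE es exprS.
have [b Tb] : exists b : {poly {poly K}}, T ^+ q.-1 = T * b.
  by exists (T ^+ s'); rewrite es' /= exprS.
rewrite -tE -/T.
have -> : (x0 ^+ q - x0) ^+ q = x0 ^+ (q ^ 2) - x0 ^+ q.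
  have fK := exprD_pchar k _ _ chp.
  have opq (a : K) : (- a) ^+ q = - (a ^+ q).
    by apply/eqP; rewrite -subr_eq0 opprK -fK addNr expr0n gtn_eqF.
  by rewrite fK opq -exprM mulnn.
exists (- u * R * (x0 ^+ q)%:P%:P + u * R' * x0%:P%:P
   + ('X^(q ^ 2))%:P * u * t ^+ s' - (u + t * u * R) * ('X^q)%:P
   + (1 + t * R') * 'X%:P * b).
rewrite Tb [t ^+ s'.+1]exprS !polyCB !polyCN !polyCB; move: (t ^+ s') => z.
by rewrite tu; ring.
Qed.

Let frobK (a b : K) : (a + b) ^+ q = a ^+ q + b ^+ q.
Proof. exact: exprD_pchar. Qed.

Lemma affQ_at0 : affQ.[0] = 1.
Proof.
have [R eR] := dicksonQ_expand ('X : {poly K}) q1.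
rewrite /affQ eR !hornerD !hornerM hornerC !horner_exp hornerX.
rewrite [0 ^+ q.-1]expr0n gtn_eqF; last by lia.
by rewrite !mul0r !addr0.
Qed.

Lemma affF1_at0 (x : {poly K}) : affF1.[x].[0] = affV.[x].[0] ^+ q.-1 + 1.
Proof.
rewrite affF1E hornerD hornerC horner_exp [LHS]hornerD; congr (_ + _).
  exact: horner_exp.
by rewrite horner_exp affQ_at0 expr1n.
Qed.

Lemma affV_curve_at0 (x0 : K) : affF1.[x0%:P].[0] = 0 ->
  affV.[x0%:P].[0] != 0 /\ affV.[x0%:P].[0] = (x0 ^+ q - x0) ^+ q.
Proof.
have q0 := ltnW q1.
have VE : affV.[x0%:P].[0] = (x0 ^+ q - x0) ^+ q.
  have [C eC] := wsub_affV_expand x0.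
  rewrite -(wsub_coef00 x0 0 q0 (b := q.-1)); last by lia.
  by rewrite eC coefD coefC coefXnM muln_gt0 q0 -subn1 subn_gt0 q1 /= addr0 coefC.
rewrite affF1_at0 VE => e.
split=> //; apply: contraTneq isT => z; move/eqP: e; rewrite z expr0n gtn_eqF; last by lia.
by rewrite add0r oner_eq0.
Qed.

(* Multiplying the curve by V turns it into V^q + Q^q V, which is additive in x. *)
Lemma affF1_fibre0 (g h : {poly {poly K}}) (x0 : K) : affF1 = g * h ->
  g.[x0%:P].[0] != 0 \/ h.[x0%:P].[0] != 0.
Proof.
move=> e; have q0 := ltnW q1.
have [F0|F0] := eqVneq (affF1.[x0%:P].[0]) 0; last first.
  by move: F0; rewrite e !hornerM mulf_eq0 negb_or => /andP[]; left.
have [V0 VE] := affV_curve_at0 F0.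
set m := x0 ^+ q - x0 in VE.
have mq : m ^+ (q ^ 2) + m ^+ q = 0.
  have : affV.[x0%:P].[0] * affF1.[x0%:P].[0] = 0 by rewrite F0 mulr0.
  rewrite affF1_at0 mulrDr mulr1 -exprS prednK //.
  by rewrite VE -exprM mulnn.
have m0 : m != 0 by apply: contraNneq V0 => z; rewrite VE z expr0n gtn_eqF.
have [C eC] := wsub_affV_expand x0; rewrite -/m in eC.
have [R eR] := dicksonQ_expand ('X ^+ q : {poly {poly K}}) q1.
pose hh : {rmorphism {poly {poly K}} -> {poly {poly K}}} := wsub q q.-1 x0 0.
have eQ : hh affQ%:P = 1 + 'X^(q * q.-1) * (1 + 'X^(q * q.-1) * R).
  transitivity (dicksonQ q (hh 'X%:P) 1).
    by rewrite -dicksonQ_affE (@rmorph_dicksonQ q _ _ hh) rmorph1.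
  by rewrite /= wsubC map_polyX hornerX !polyC0 add0r eR [_ ^+ q.-1](esym (exprM _ _ _)); ring.
have [s es] : exists s : nat, (q * q.-1)%N = s.+1.
  by exists (q * q.-1).-1; rewrite prednK // muln_gt0 q0; lia.
have [s' es'] : exists s' : nat, q = s'.+2 by exists q.-2; lia.
set t : {poly {poly K}} := 'X^(q * q.-1) in eC eQ.
have tq : t ^+ q = t * 'X * ('X^s * t ^+ s').
  have tX : t = 'X * 'X^s by rewrite -exprS -es.
  by rewrite es' !exprS {2}tX; ring.
pose E := ('X^s * t ^+ s') * ((- m%:P - 'X^q)%:P + 'X * C) ^+ q
   + ('X^s * t ^+ s') * (1 + t * R) ^+ q * ((m ^+ q)%:P%:P + t * ((- m%:P - 'X^q)%:P + 'X * C)) + C.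
(* The constant terms [m^(q^2)] and [m^q] cancel. The part of order t, namely [-m - S^q], comes from
   [Q^q * V] alone, since the terms raised to the q-th power have higher order; [E] collects
   them. *)
have eW : hh (g * (h * affV)) = t * ((- m%:P - 'X^q)%:P + 'X * E).
  rewrite mulrA -e affF1E mulrDl -exprSr prednK // rmorphD rmorphM !rmorphXn /=.
  rewrite -[wsub _ _ _ _ (_%:P)]/(hh _) [hh affQ%:P]eQ eC -/t !frob.
  rewrite expr1n !exprMn tq -!polyC_exp -exprM mulnn.
  have -> : m ^+ (q ^ 2) = - m ^+ q by apply/eqP; rewrite -addr_eq0 mq.
  by rewrite /E !polyCN; ring.
have [] := newton_segment (a := q) (b := q.-1) (c0 := - m) (c1 := -1) q0 _ _ eW.
- by lia.
- by rewrite -[in X in coprime X _](prednK q0) coprime_sym; exact: coprimenS.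
- rewrite coefD coefC coefXM eqxx addr0 polyCN scaleN1r addrC //.
- by rewrite oppr_eq0.
- by rewrite oppr_eq0 oner_eq0.
- by left.
- by rewrite !hornerM mulf_eq0 negb_or => /andP[? _]; right.
Qed.

(** The substitution y -> y + z belongs to the group; it transports the study of the fibre y = 0 to
    the fibre y = 1. *)
Lemma affF1_shift : map_poly (comp_poly ('X + 1)) affF1 = affF1.
Proof.
pose hh : {rmorphism {poly {poly K}} -> {poly {poly K}}} := map_poly (comp_poly ('X + 1)).
transitivity (curve1 q (hh 'X) (hh 'X%:P) (hh 1)).
  exact: (@rmorph_curve1 q _ _ hh).
rewrite rmorph1 /= map_polyX map_polyC /= comp_polyX polyCD polyC1.
have := @curve1_lin q (ltnW q1) {poly {poly K}} frob 1 1 0 1.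
rewrite expr1n expr0n gtn_eqF ?(ltnW q1) // mulr1 mulr0 subr0 oner_eq0.
move/(_ erefl erefl erefl erefl isT 1 0 0).
rewrite expr1n expr0n gtn_eqF ?(ltnW q1) // oner_eq0.
move/(_ erefl erefl erefl isT 'X _ _ (dicksonL_aff_neq0 chp k0)).
by rewrite !mul0r !mul1r !add0r => ->.
Qed.

Lemma affF1_fibre1 (g h : {poly {poly K}}) (x0 : K) : affF1 = g * h ->
  g.[x0%:P].[1] != 0 \/ h.[x0%:P].[1] != 0.
Proof.
move=> e; have e' := affF1_shift; rewrite {1}e rmorphM /= in e'.
have sh (P : {poly {poly K}}) :
    (map_poly (comp_poly ('X + 1)) P).[x0%:P].[0] = P.[x0%:P].[1].
  elim/poly_ind: P => [|P c IH]; first by rewrite rmorph0 !horner0.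
  rewrite rmorphD rmorphM /= map_polyX map_polyC !hornerMXaddC !hornerD !hornerM !hornerC IH.
  by rewrite /= horner_comp hornerD hornerX hornerC add0r.
by have := affF1_fibre0 x0 (esym e'); rewrite !sh.
Qed.

Lemma affF1_translate (f g : K) : in_Fq q f -> in_Fq q g ->
  affF1 \Po ('X + (f *: 'X + g%:P)%:P) = affF1.
Proof.
move=> fq gq; rewrite affF1E comp_polyD comp_polyC.
by rewrite [(_ ^+ _) \Po _](rmorphXn (comp_poly _)) /= affV_translate.
Qed.

Lemma lead_coef_affF1 : lead_coef affF1 = 1.
Proof.
have s1 := size_affVX_gt1.
rewrite affF1E lead_coefDl; last by rewrite size_polyC (leq_ltn_trans _ s1) // leq_b1.
by apply/eqP; rewrite -monicE monic_exp // affV_monic.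
Qed.

Lemma lead_coef_factor_affF1 (g h : {poly {poly K}}) : affF1 = g * h ->
  exists2 c : K, c != 0 & lead_coef g = c%:P.
Proof.
move=> e; have := lead_coef_affF1; rewrite e lead_coefM.
move/(congr1 (fun P : {poly K} => size P)); rewrite size_poly1 => /eqP.
rewrite size_mul_eq1 => /andP[/eqP s _]; exists (lead_coef g)`_0; last first.
  by apply: size1_polyC; rewrite s.
have lg0 : lead_coef g != 0 by rewrite -size_poly_eq0 s.
by move: lg0; rewrite -lead_coef_eq0 lead_coefE s.
Qed.

(** [a y + b] is the sum of [(a + b) y], zero on the fibre y = 0, and [-b y + b], zero on the fibre
    y = 1. Each of the two translations is trivial on a fibre where the factors have no common
    point, so [coprime_fibre_translate] applies to it. *)
Lemma affF1_factor_invariant (g h : {poly {poly K}}) (a b : K) :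
  affF1 = g * h -> (1 < size g)%N -> (1 < size h)%N -> in_Fq q a -> in_Fq q b ->
  g \Po ('X + (a *: 'X + b%:P)%:P) = g.
Proof.
move=> e sg sh aq bq.
have [cg cg0 lg] := lead_coef_factor_affF1 e.
have [ch ch0 lh] : exists2 c : K, c != 0 & lead_coef h = c%:P.
  by rewrite mulrC in e; exact: lead_coef_factor_affF1 e.
have Fq0 : in_Fq q (0 : K) by rewrite /in_Fq expr0n gtn_eqF // ltnW.
have opq (c : K) : in_Fq q c -> in_Fq q (- c).
  move=> /eqP cq; apply/eqP; apply/eqP; rewrite -subr_eq0 -{2}cq opprK -frobK addNr.
  by rewrite expr0n gtn_eqF // ltnW.
have abq : in_Fq q (a + b) by rewrite /in_Fq frobK (eqP aq) (eqP bq).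
have i0 : g \Po ('X + ((a + b) *: 'X + 0%:P)%:P) = g.
  apply: (coprime_fibre_translate (c := 0) e) => //; rewrite ?lg ?lh ?hornerC //.
  - exact: affF1_translate.
  - by rewrite hornerD hornerZ hornerX mulr0 hornerC addr0.
  - by move=> x; exact: affF1_fibre0.
have i1 : g \Po ('X + ((- b) *: 'X + b%:P)%:P) = g.
  apply: (coprime_fibre_translate (c := 1) e) => //; rewrite ?lg ?lh ?hornerC //.
  - by apply: affF1_translate => //; exact: opq.
  - by rewrite hornerD hornerZ hornerX mulr1 hornerC addNr.
  - by move=> x; exact: affF1_fibre1.
have -> : a *: 'X + b%:P = ((a + b) *: 'X + 0%:P) + ((- b) *: 'X + b%:P).
  by rewrite polyC0 addr0 scalerDl scaleNr addrA addrK.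
by rewrite -(comp_translate g) i0 i1.
Qed.

(** As t is a simple root, [Q] is [c (y - t)] to first order with c nonzero, and [y - t] becomes
    [T^(q-1)]. *)
Lemma affQ_expand t : root affQ t -> exists2 c : K, c != 0 & exists C : {poly {poly K}},
  wsub q.-1 q 0 t affQ%:P = 'X^(q.-1) * (c%:P%:P + 'X * C).
Proof.
move=> Qt; have QL := affQ_root_simple Qt.
have [Q1 eQ1] := factor_theorem _ _ Qt.
have c0 : Q1.[t] != 0.
  apply: contraTneq isT => z; move/eqP: QL.
  rewrite {1}eQ1 derivM hornerD !hornerM z hornerD hornerN hornerX hornerC subrr mulr0.
  by rewrite mul0r addr0 mul0r eq_sym oppr_eq0 oner_eq0.
exists Q1.[t] => //.
have [Q2 eQ2] : exists Q2, Q1 = Q1.[t]%:P + Q2 * ('X - t%:P).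
  have : root (Q1 - Q1.[t]%:P) t by rewrite rootE hornerD hornerN hornerC subrr.
  by case/factor_theorem => Q2 e; exists Q2; rewrite -e addrC subrK.
have evX : (map_poly (polyC \o polyC) ('X - t%:P)).[t%:P%:P + 'X^(q.-1)] = 'X^(q.-1) :> {poly {poly K}}.
  by rewrite rmorphB /= map_polyX map_polyC !hornerD hornerN hornerX hornerC /= addrAC subrr add0r.
exists ((map_poly (polyC \o polyC) Q2).[t%:P%:P + 'X^(q.-1)] * 'X^(q.-2)).
have -> : 'X * ((map_poly (polyC \o polyC) Q2).[t%:P%:P + 'X^(q.-1)] * 'X^(q.-2)) =
   (map_poly (polyC \o polyC) Q2).[t%:P%:P + 'X^(q.-1)] * 'X^(q.-1) :> {poly {poly K}}.
  by rewrite mulrCA -exprS prednK //; lia.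
rewrite wsubC eQ1 rmorphM hornerM evX {1}eQ2 rmorphD rmorphM !hornerD hornerM evX.
by rewrite /= map_polyC hornerC /= mulrC.
Qed.

(** Both factors are polynomials in [V], which reduces the problem to factoring [X^(q-1) + Q^q] with
    a new variable X in place of [V]. The cusp at X = 0 over a root t of [Q] lets at most one factor
    vanish there, and the other one is then constant in X. *)
Lemma affF1_irreducible (g h : {poly {poly K}}) : affF1 = g * h ->
  (exists c : K, g = c%:P%:P) \/ (exists c : K, h = c%:P%:P).
Proof.
have vert (g' h' : {poly {poly K}}) : affF1 = g' * h' -> (size g' <= 1)%N ->
    exists c : K, g' = c%:P%:P.
  move=> e /size1_polyC s; have [c _ lc] := lead_coef_factor_affF1 e.
  by exists c; rewrite -lc [in RHS]s lead_coefC.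
move=> e.
have [|sg] := leqP (size g) 1; first by move/(vert _ _ e); left.
have [|sh] := leqP (size h) 1; first by rewrite mulrC in e; move/(vert _ _ e); right.
exfalso; have q0 := ltnW q1.
have [rs [urs srs _ mrs]] := Fq_enum chp k0.
have dec (g' h' : {poly {poly K}}) : affF1 = g' * h' -> (1 < size g')%N -> (1 < size h')%N ->
    exists G, g' = G \Po affV.
  move=> e' sg' sh'; apply: (comp_affV chp k0 urs srs mrs) => b /allpairsP[[c d] [/= cr dr ->]].
  by apply: (affF1_factor_invariant e'); rewrite // -mrs.
have [G gG] := dec _ _ e sg sh.
have [H hH] : exists H, h = H \Po affV by apply: dec sh sg; rewrite mulrC.
have eGH : G * H = 'X^(q.-1) + (affQ ^+ q)%:P.
  apply: (@comp_poly_inj _ affV); first by rewrite size_affV // ltnS expn_gt0 q0.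
  by rewrite comp_polyM -gG -hH -e affF1E comp_polyD comp_Xn_poly comp_polyC.
have [t Qt] := closed_rootP affQ (negbT (gtn_eqF size_affQ_gt1)).
have [c c0 [C eC]] := affQ_expand Qt.
pose hh : {rmorphism {poly {poly K}} -> {poly {poly K}}} := wsub q.-1 q 0 t.
have eW : hh (G * H) = 'X^(q.-1 * q) * (('X^(q.-1))%:P + (c%:P%:P + 'X * C) ^+ q).
  rewrite eGH rmorphD polyC_exp !rmorphXn.
  have -> : hh 'X = 'X%:P * 'X^q by rewrite /= wsubX !polyC0 add0r.
  have -> : hh affQ%:P = 'X^(q.-1) * (c%:P%:P + 'X * C) by [].
  by rewrite !exprMn -!exprM -polyC_exp mulnC; ring.
have qp0 : (0 < q.-1)%N by lia.
(* A factor nonzero at the cusp has no root on the fibre y = t, where the product is [X^(q-1)]; its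
   leading coefficient does not vanish there, so it has degree 0 in X. *)
have key (G' H' : {poly {poly K}}) : G' * H' = 'X^(q.-1) + (affQ ^+ q)%:P ->
    H'.[0].[t] != 0 -> (size H' <= 1)%N.
  move=> eGH' H0; pose ev := map_poly (horner_eval t).
  have evGH : ev G' * ev H' = 'X^(q.-1).
    rewrite -rmorphM /= eGH' rmorphD rmorphXn /= map_polyX map_polyC /= /horner_eval.
    by rewrite horner_exp (eqP Qt) expr0n gtn_eqF // addr0.
  have sev : size (ev H') = 1%N.
    apply/eqP; apply/negPn/negP => /closed_rootP[z rz].
    have : ('X^(q.-1)).[z] = 0 by rewrite -evGH hornerM (eqP rz) mulr0.
    rewrite hornerXn => /eqP; rewrite expf_eq0 => /andP[_ /eqP z0].
    by move: rz H0; rewrite z0 rootE horner_map_eval polyC0 => ->.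
  have lH : (lead_coef H').[t] != 0.
    have : lead_coef (G' * H') = 1.
      rewrite eGH' lead_coefDl ?lead_coefXn // size_polyC size_polyXn.
      by rewrite (leq_ltn_trans (leq_b1 _)).
    rewrite lead_coefM => /(congr1 (fun P : {poly K} => P.[t])).
    rewrite hornerM hornerC => z; apply: contraTneq isT => z'.
    by move/eqP: z; rewrite z' mulr0 eq_sym oner_eq0.
  by move: sev; rewrite /ev size_map_poly_id0 // => ->.
have small (G' : {poly {poly K}}) : (size G' <= 1)%N -> (size (G' \Po affV) <= 1)%N.
  by move=> /size1_polyC ->; rewrite comp_polyC size_polyC leq_b1.
have [] := newton_segment (a := q.-1) (b := q) (c0 := c ^+ q) (c1 := 1) qp0 q0 _ eW.
- by rewrite -[in X in coprime _ X](prednK q0); exact: coprimenS.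
- rewrite coefD coefC /= -horner_coef0 horner_exp hornerD hornerM hornerX mul0r addr0.
  by rewrite hornerC scale1r -polyC_exp.
- by rewrite expf_neq0.
- by rewrite oner_eq0.
- rewrite polyC0 => G0; move: sg; rewrite gG ltnNge => /negP; apply.
  by apply: small; apply: (key H G) => //; rewrite mulrC.
- rewrite polyC0 => H0; move: sh; rewrite hH ltnNge => /negP; apply.
  by apply: small; apply: (key G H).
Qed.

End Chart.

(** * Invariant curves at a rational point *)

Section Homogeneity.
Variables (K : fieldType) (q : nat).
Hypothesis q1 : (1 < q)%N.
Local Notation x := ('X_i2 : {mpoly K[3]}).
Local Notation y := ('X_i0 : {mpoly K[3]}).
Local Notation z := ('X_i1 : {mpoly K[3]}).

Lemma dhomog_X1 i n : ('X_i : {mpoly K[3]}) ^+ n \is n.-homog.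
Proof.
rewrite -[in X in X.-homog](mul1n n); apply: dhomogMn.
by rewrite dhomogX; apply/eqP/mdeg1.
Qed.

Lemma dhomog_dicksonL : dicksonL q y z \is q.+1.-homog.
Proof.
rewrite /dicksonL; apply: rpredB.
  have -> : q.+1 = (q + 1)%N by rewrite addn1.
  by apply: dhomogM; [exact: dhomog_X1 | exact: (dhomog_X1 _ 1)].
have -> : q.+1 = (1 + q)%N by rewrite add1n.
by apply: dhomogM; [exact: (dhomog_X1 _ 1) | exact: dhomog_X1].
Qed.

Lemma dhomog_dicksonQ : dicksonQ q y z \is (q ^ 2 - q).-homog.
Proof.
apply: rpred_sum => i _; rewrite -!exprM.
have -> : (q ^ 2 - q = q.-1 * (q - i) + q.-1 * i)%N.
  by rewrite -mulnDr subnK ?(leq_ord i) // -mulnn; case: (q) q1 => // r _; lia.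
by apply: dhomogM; exact: dhomog_X1.
Qed.

Lemma dhomog_orbitV : orbitV q x y z \is (q ^ 2).-homog.
Proof.
rewrite /orbitV; apply: rpredD; [apply: rpredB|]; first exact: dhomog_X1.
- have -> : (q ^ 2 = (q ^ 2 - q) + q)%N by rewrite subnK // -mulnn; nia.
  by apply: dhomogM; [exact: dhomog_dicksonQ | exact: dhomog_X1].
- have -> : (q ^ 2 = q.+1 * q.-1 + 1)%N by rewrite -mulnn; case: (q) q1 => // r _; lia.
  apply: dhomogM; last exact: (dhomog_X1 _ 1).
  by apply: dhomogMn; exact: dhomog_dicksonL.
Qed.

Lemma dhomog_curve1 : curve1 q x y z \is (q ^ 3 - q ^ 2).-homog.
Proof.
rewrite /curve1; apply: rpredD.
  have -> : (q ^ 3 - q ^ 2 = q ^ 2 * q.-1)%N by rewrite (expnD q 2 1); case: (q) q1 => // r _; rewrite -mulnn; lia.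
  by apply: dhomogMn; exact: dhomog_orbitV.
have -> : (q ^ 3 - q ^ 2 = (q ^ 2 - q) * q)%N by rewrite mulnBl !expnS expn0; lia.
by apply: dhomogMn; exact: dhomog_dicksonQ.
Qed.

Lemma dhomog_curve2 : curve2 q x y z \is (q ^ 3 - q).-homog.
Proof.
rewrite /curve2; apply: rpredD.
  have -> : (q ^ 3 - q = q ^ 2 * q.-1 + (q ^ 2 - q))%N.
    by case: (q) q1 => // r _; rewrite !expnS expn0 /=; lia.
  apply: dhomogM; last exact: dhomog_dicksonQ.
  by apply: dhomogMn; exact: dhomog_orbitV.
have -> : (q ^ 3 - q = q.+1 * (q * q.-1))%N.
  by case: (q) q1 => // r _; rewrite !expnS expn0 /=; lia.
by apply: dhomogMn; exact: dhomog_dicksonL.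
Qed.

End Homogeneity.

Section Specialization.
Variables (K : fieldType) (S : comNzRingType) (f : {rmorphism K -> S}) (v : 'I_3 -> S).
Variable q : nat.
Let h : {rmorphism {mpoly K[3]} -> S} := mmap f v.
Let hX i : h 'X_i = v i. Proof. by rewrite /= mmapX mmap1U. Qed.

Lemma mmap_dicksonL : mmap f v (dicksonL q 'X_i0 'X_i1) = dicksonL q (v i0) (v i1).
Proof. by rewrite -!hX; exact: (@rmorph_dicksonL q _ _ h). Qed.

Lemma mmap_curve1 :
  mmap f v (curve1 q 'X_i2 'X_i0 'X_i1) = curve1 q (v i2) (v i0) (v i1).
Proof. by rewrite -!hX; exact: (@rmorph_curve1 q _ _ h). Qed.

Lemma mmap_curve2 :
  mmap f v (curve2 q 'X_i2 'X_i0 'X_i1) = curve2 q (v i2) (v i0) (v i1).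
Proof. by rewrite -!hX; exact: (@rmorph_curve2 q _ _ h). Qed.

End Specialization.

Section StandardPoint.
Variables (K : closedFieldType) (p k : nat).
Hypotheses (chp : p \in [pchar K]) (k0 : (0 < k)%N).
Local Notation q := (p ^ k)%N.
Local Notation x := ('X_i2 : {mpoly K[3]}).
Local Notation y := ('X_i0 : {mpoly K[3]}).
Local Notation z := ('X_i1 : {mpoly K[3]}).
Let q1 := q_gt1 chp k0.
Let frob (a b : {mpoly K[3]}) : (a + b) ^+ q = a ^+ q + b ^+ q.
Proof. by apply: exprD_pchar; exact: (rmorph_pchar (@mpolyC 3 K)). Qed.

Lemma dehom_curve1 : dehom (curve1 q x y z) = affF1 K p k.
Proof. exact: mmap_curve1. Qed.

Lemma dehom_curve2 : dehom (curve2 q x y z) = affF2 K p k.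
Proof. exact: mmap_curve2. Qed.

Lemma dicksonL_neq0 : dicksonL q y z != 0.
Proof.
apply: contraTneq isT => e; have := congr1 (@dehom K) e.
rewrite [LHS]mmap_dicksonL rmorph0 => /eqP.
by rewrite (negPf (dicksonL_aff_neq0 chp k0)).
Qed.

(** The line z = 0 with y = 1 and parameter x. On it [Q = 1], [L = 0] and [V = x^(q^2) - x^q], which
    shows that z divides neither curve. *)
Let v (i : 'I_3) : {poly K} := tnth [tuple 1; 0; 'X] i.

Let dicksonQ10 : dicksonQ q 1 0 = 1 :> {poly K}.
Proof.
rewrite /dicksonQ big_ord_recl big1 => [|i _].
  by rewrite !expr1n expr0 mulr1 addr0.
by rewrite [0 ^+ q.-1]expr0n gtn_eqF ?mulr0n ?exprS ?mul0r ?mulr0 //; lia.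
Qed.

Let dicksonL10 : dicksonL q 1 0 = 0 :> {poly K}.
Proof. by rewrite /dicksonL expr0n gtn_eqF ?(ltnW q1) // mulr0 mul1r subrr. Qed.

Let orbitV10 : orbitV q 'X 1 0 = 'X^(q ^ 2) - 'X^q :> {poly K}.
Proof.
by rewrite /orbitV dicksonQ10 dicksonL10 expr0n gtn_eqF ?mul0r ?addr0 ?mul1r //; lia.
Qed.

Lemma mirreducible_curve1 : mirreducible (curve1 q x y z).
Proof.
apply: (@mirreducible_dehom K _ _ {poly K} (@polyC K) v (dhomog_curve1 K q1)) => //.
- by rewrite subn_gt0 ltn_exp2l.
- by rewrite dehom_curve1; exact: affF1_irreducible.
- rewrite mmap_curve1 /v /tnth /= /curve1 orbitV10 dicksonQ10.
  have V0 : ('X^(q ^ 2) - 'X^q : {poly K}).[0] = 0.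
    rewrite hornerD hornerN !hornerXn !expr0n -mulnn muln_eq0 gtn_eqF ?(ltnW q1) //.
    by rewrite subrr.
  apply: contraTneq isT => /(congr1 (fun P : {poly K} => P.[0])) /eqP.
  rewrite hornerD horner_exp V0 expr1n hornerC horner0 expr0n gtn_eqF; last by lia.
  by rewrite add0r oner_eq0.
Qed.

Lemma mirreducible_curve2 : mirreducible (curve2 q x y z).
Proof.
apply: (@mirreducible_dehom K _ _ {poly K} (@polyC K) v (dhomog_curve2 K q1)) => //.
- by rewrite subn_gt0 -{1}(expn1 q) ltn_exp2l.
- by rewrite dehom_curve2; exact: affF2_irreducible.
- rewrite mmap_curve2 /v /tnth /= /curve2 orbitV10 dicksonQ10 dicksonL10.
  rewrite mulr1 expr0n gtn_eqF ?muln_gt0 ?(ltnW q1) ?addr0; last by lia.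
  rewrite expf_neq0 // -size_poly_eq0 size_polyDl size_polyXn // size_polyN size_polyXn ltnS.
  by rewrite -{1}(expn1 q) ltn_exp2l.
Qed.

Section Invariance.
Variable A : 'M[K]_3.
Hypotheses (FA : Fq_mx q A) (uA : A \in unitmx) (A02 : A i0 i2 = 0) (A12 : A i1 i2 = 0).

Let fx i j : (A i j)%:MP_[3] ^+ q = (A i j)%:MP_[3].
Proof. by rewrite -rmorphXn /= (eqP (FA i j)). Qed.

Let D0 : (A i2 i2 != 0) /\ (A i0 i0 * A i1 i1 - A i0 i1 * A i1 i0 != 0).
Proof. by move: uA; rewrite unitmxE det_stab // unitfE mulf_eq0 negb_or => /andP[]. Qed.

Let D0' : (A i0 i0)%:MP_[3] * (A i1 i1)%:MP_[3] - (A i0 i1)%:MP_[3] * (A i1 i0)%:MP_[3] != 0.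
Proof. by rewrite -!rmorphM -rmorphB /= mpolyC_eq0; case: D0. Qed.

Let E0 : (A i2 i2)%:MP_[3] != 0.
Proof. by rewrite mpolyC_eq0; case: D0. Qed.

Let substX i : tnth (lin_subst A) i =
  (A i i0)%:MP * y + (A i i1)%:MP * z + (A i i2)%:MP * x.
Proof. by rewrite tnth_mktuple sum3E !mul_mpolyC. Qed.

Let substy : tnth (lin_subst A) i0 = (A i0 i0)%:MP * y + (A i0 i1)%:MP * z.
Proof. by rewrite substX A02 mpolyC0 mul0r addr0. Qed.

Let substz : tnth (lin_subst A) i1 = (A i1 i0)%:MP * y + (A i1 i1)%:MP * z.
Proof. by rewrite substX A12 mpolyC0 mul0r addr0. Qed.

Lemma curve1_invariant : curve_invariant A (curve1 q x y z).
Proof.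
exists 1; first by rewrite oner_eq0.
rewrite scale1r [LHS]mmap_curve1 substX substy substz.
by apply: curve1_lin; rewrite ?(ltnW q1) ?dicksonL_neq0.
Qed.

Lemma curve2_invariant : curve_invariant A (curve2 q x y z).
Proof.
exists 1; first by rewrite oner_eq0.
rewrite scale1r [LHS]mmap_curve2 substX substy substz.
by apply: curve2_lin; rewrite ?(ltnW q1) ?dicksonL_neq0.
Qed.

End Invariance.

Definition std_point : 'cV[K]_3 := delta_mx i2 0.

Lemma std_stab (A : 'M[K]_3) : (exists c, A *m std_point = c *: std_point) <->
  (A i0 i2 = 0 /\ A i1 i2 = 0).
Proof.
have E : A *m std_point = col i2 A by rewrite colE.
rewrite E; split=> [[c e]|[A02 A12]].
  have h i := congr1 (fun M : 'cV[K]_3 => M i 0) e.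
  by split; [have := h i0 | have := h i1]; rewrite !mxE /= mulr0.
exists (A i2 i2); apply/matrixP => i j; rewrite ord1 !mxE; move: i.
by apply: ord3P; rewrite ?A02 ?A12 ?mulr0 ?mulr1.
Qed.

Lemma first_gap_std : first_gap (inv_irr_degree (AGLbar_elt q std_point)) (q ^ 2 - q).
Proof.
have low n F : (2 <= n)%N -> F \is n.-homog -> mirreducible F ->
    (forall A, AGLbar_elt q std_point A -> curve_invariant A F) ->
    forall a b c d f g e : K,
    in_Fq q a -> in_Fq q b -> in_Fq q c -> in_Fq q d ->
    in_Fq q f -> in_Fq q g -> in_Fq q e -> (a * d - b * c) * e != 0 ->
    curve_invariant (stab_mx a b c d f g e) F.
  move=> _ _ _ inv a b c d f g e ha hb hc hd hf hg he nz; apply: inv; split.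
  - have h0 : in_Fq q (0 : K) by rewrite /in_Fq expr0n gtn_eqF // ltnW.
    by move=> i j; rewrite mxE; move: i; apply: ord3P; move: j; apply: ord3P.
  - by rewrite stab_mx_unit.
  - by apply/std_stab; rewrite !mxE.
have dE : (q ^ 3 - q ^ 2 + (q ^ 2 - q) = q ^ 3 - q)%N.
  by rewrite addnBA ?subnK // ?leq_exp2l // -{1}(expn1 q) leq_exp2l.
exists (q ^ 3 - q ^ 2)%N; split.
- split; first by move: q1; case: (q) => [|[|r]] // _; rewrite !expnS expn0; nia.
  exists (curve1 q x y z); split; first exact: dhomog_curve1.
    exact: mirreducible_curve1.
  by move=> A [FA uA /std_stab [A02 A12]]; exact: curve1_invariant.
- move=> n n2 [F [hF irr inv]].
  exact: (invariant_degree_ge chp k0 n2 hF irr (low n F n2 hF irr inv)).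
- rewrite dE; exists (curve2 q x y z); split; first exact: dhomog_curve2.
    exact: mirreducible_curve2.
  by move=> A [FA uA /std_stab [A02 A12]]; exact: curve2_invariant.
- by rewrite subn_gt0 -{1}(expn1 q) ltn_exp2l.
- move=> n; rewrite dE => lo hi [F [hF irr inv]].
  have n2 : (2 <= n)%N.
    apply: leq_trans (ltnW lo); move: q1; case: (q) => [|[|r]] // _; rewrite !expnS expn0; nia.
  exact: (invariant_degree_gap chp k0 n2 hF irr (low n F n2 hF irr inv) lo hi).
Qed.

(** * Matrices over F_q and transfer to an arbitrary rational point *)

Definition frobq (u : K) : K := u ^+ q.

Lemma frobq_additive : additive frobq.
Proof.
move=> a b; have fK c d : frobq (c + d) = frobq c + frobq d by exact: exprD_pchar.
by apply/eqP; rewrite eq_sym subr_eq -fK subrK.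
Qed.

Lemma frobq_multiplicative : multiplicative frobq.
Proof. by split=> [a b|]; rewrite /frobq ?exprMn ?expr1n. Qed.

HB.instance Definition _ := GRing.isAdditive.Build K K frobq frobq_additive.
HB.instance Definition _ := GRing.isMultiplicative.Build K K frobq frobq_multiplicative.

(** With F_q seen as the fixed field of the morphism [frobq], closure of F_q-matrices under products
    and inverses follows from functoriality of [map_mx]. *)
Lemma Fq_mxE m n (A : 'M[K]_(m, n)) : Fq_mx q A <-> map_mx frobq A = A.
Proof.
split=> [h|h i j]; first by apply/matrixP => i j; rewrite mxE; apply/eqP/h.
by have := congr1 (fun M : 'M_(m, n) => M i j) h; rewrite mxE => /eqP.
Qed.

Lemma Fq_mxM m n l (A : 'M[K]_(m, n)) (B : 'M[K]_(n, l)) :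
  Fq_mx q A -> Fq_mx q B -> Fq_mx q (A *m B).
Proof. by move=> /Fq_mxE hA /Fq_mxE hB; apply/Fq_mxE; rewrite map_mxM /= hA hB. Qed.

Lemma Fq_mxV n (A : 'M[K]_n) : Fq_mx q A -> Fq_mx q (invmx A).
Proof. by move=> /Fq_mxE hA; apply/Fq_mxE; rewrite map_invmx /= hA. Qed.

(** [w] completes to a basis: a row swap makes its last entry nonzero, the result replaces the last
    column of the identity, which gives an invertible triangular matrix, and the rows are swapped
    back. *)
Lemma Fq_frame (w : 'cV[K]_3) : PG2q_point q w ->
  exists B : 'M[K]_3, [/\ B \in unitmx, Fq_mx q B & B *m std_point = w].
Proof.
case=> w0 Fw.
have F0 : in_Fq q (0 : K) by rewrite /in_Fq expr0n gtn_eqF // ltnW.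
have F1 : in_Fq q (1 : K) by rewrite /in_Fq expr1n.
have [i wi] : exists i, w i 0 != 0.
  apply/existsP; apply: contraNT w0; rewrite negb_exists => /forallP h.
  by apply/eqP/matrixP => i j; rewrite ord1 mxE; apply/eqP; rewrite -[_ == _]negbK h.
pose u := xrow i i2 w.
have u2 : u i2 0 != 0 by rewrite mxE /= tpermR.
pose M : 'M[K]_3 := \matrix_(r, s) if s == i2 then u r 0 else (r == s)%:R.
exists (xrow i i2 M); split.
- rewrite xrowE unitmx_mul unitmx_perm /= -unitmx_tr unitmxE.
  rewrite det_trig; last first.
    apply/is_trig_mxP => r s rs; rewrite !mxE; case: eqP => [e|_].
      by move: rs; rewrite e ltnNge -ltnS ltn_ord.
    by case: eqP rs => [->|//]; rewrite ltnn.
  rewrite unitfE; apply/prodf_neq0 => r _; rewrite !mxE eqxx.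
  have [->|_] := eqVneq r i2; last by rewrite oner_eq0.
  by rewrite tpermR.
- by move=> r s; rewrite !mxE; case: ifP => _; [exact: Fw | case: eqP].
- by rewrite -colE; apply/matrixP => r s; rewrite !mxE eqxx ord1 tpermK.

Qed.

End StandardPoint.

(** The pullback by [B] of a form invariant under [B A B^(-1)] is invariant under [A], and it keeps
    degree and irreducibility. *)
Lemma inv_irr_degree_conj (K : closedFieldType) (G G' : 'M[K]_3 -> Prop) (B : 'M[K]_3) n :
  B \in unitmx -> (forall A, G' A -> G (B *m A *m invmx B)) ->
  inv_irr_degree G n -> inv_irr_degree G' n.
Proof.
move=> uB GG [F [hF irr inv]]; exists (F \mPo lin_subst B); split.
- exact: dhomog_lin_subst.
- exact: mirreducible_lin_subst.
- move=> A /GG /inv [c c0 e]; exists c => //.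
  by rewrite lin_subst_comp -[B *m A](mulmxKV uB) -lin_subst_comp e linearZ.
Qed.

Lemma first_gap_ext (S T : nat -> Prop) e : (forall n, S n <-> T n) ->
  first_gap S e -> first_gap T e.
Proof.
move=> ST [d [[d2 Sd] low Sde e0 gap]]; exists d; split=> //.
- by split=> //; apply/ST.
- by move=> n n2 /ST; exact: low.
- exact/ST.
- by move=> n lo hi /ST; exact: gap.
Qed.

Theorem mainTheorem5 (K : closedFieldType) (p k : nat) (v : 'cV[K]_3) :
  prime p -> p \in [pchar K] -> alg_over_prime_field K -> (0 < k)%N ->
  PG2q_point (p ^ k)%N v ->
  first_gap (inv_irr_degree (AGLbar_elt (p ^ k)%N v)) ((p ^ k) ^ 2 - p ^ k)%N.
Proof.
move=> _ chp _ k0 /(Fq_frame chp k0) [B [uB FB Be]].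
apply: first_gap_ext (first_gap_std chp k0) => n.
have uB' : invmx B \in unitmx by rewrite unitmx_inv.
have Be' : std_point K = invmx B *m v by rewrite -Be mulKmx.
have FB' := Fq_mxV chp FB.
split; [apply: (inv_irr_degree_conj uB') | apply: (inv_irr_degree_conj uB)] => A [FA uA [c Ac]].
  rewrite invmxK; split.
  - by apply: (Fq_mxM chp) FB; apply: (Fq_mxM chp).
  - by rewrite !unitmx_mul uB' uA.
  - by exists c; rewrite -(mulmxA _ B) Be -mulmxA Ac -scalemxAr -Be'.
split.
- by apply: (Fq_mxM chp) FB'; apply: (Fq_mxM chp).
- by rewrite !unitmx_mul uB uA.
- by exists c; rewrite -(mulmxA _ (invmx B)) -Be' -mulmxA Ac -scalemxAr Be.
Qed.
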